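(* Let $P(\lambda)=\begin{bmatrix}-A(\lambda)&B(\lambda)\\ C(\lambda)&D(\lambda)\end{bmatrix}\in\mathbb{C}[\lambda]^{(n+p)\times(n+p)}$ be a regular polynomial system matrix, with $A(\lambda)\in\mathbb{C}[\lambda]^{n\times n}$ regular, $D(\lambda)\in\mathbb{C}[\lambda]^{p\times p}$, and transfer function matrix $R(\lambda)=D(\lambda)+C(\lambda)A(\lambda)^{-1}B(\lambda)$. Assume that $\lambda_0\in\mathbb{C}$ is a simple zero of $R(\lambda)$ and that $P(\lambda)$ is minimal at $\lambda_0$. Let the perturbations of the coefficients of the blocks of $P(\lambda)$ be bounded by $\|\Delta A_i\|_2\le a_i$, $\|\Delta B_i\|_2\le b_i$, $\|\Delta C_i\|_2\le c_i$, $\|\Delta D_i\|_2\le d_i$, with nonnegative weights $a_i,b_i,c_i,d_i$, and let $$p_i:=\Big(\max_{v^2+w^2=1}(a_iv+b_iw)^2+(c_iv+d_iw)^2\Big)^{1/2}$$ (maximum over real $v,w$). Then $$\kappa_S(\lambda_0)\le\kappa_U(\lambda_0),$$ where $\kappa_S(\lambda_0)$ is the structured absolute condition number with weights $a_i,b_i,c_i,d_i$ and $\kappa_U(\lambda_0)$ is the unstructured absolute condition number of $\lambda_0$ as an eigenvalue of $P(\lambda)$ with weights $p_i$.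
   Context: A square polynomial or rational matrix is regular if its determinant is not identically zero. $P(\lambda)$ is minimal at $\lambda_0$ if $\begin{bmatrix}-A(\lambda_0)\\C(\lambda_0)\end{bmatrix}$ has full column rank and $\begin{bmatrix}A(\lambda_0)&B(\lambda_0)\end{bmatrix}$ has full row rank. For every regular rational matrix $R(\lambda)\in\mathbb{C}(\lambda)^{p\times p}$ and $\lambda_0\in\mathbb{C}$ there are rational matrices $G_1,G_2$ invertible at $\lambda_0$ (no pole at $\lambda_0$ and nonzero determinant there) with $G_1RG_2=\mathrm{diag}((\lambda-\lambda_0)^{\nu_1},\dots,(\lambda-\lambda_0)^{\nu_p})$, with uniquely determined integers $\nu_1\le\dots\le\nu_p$. $\lambda_0$ is a zero (eigenvalue) of $R$ if some $\nu_i>0$; it is simple if exactly one $\nu_i$ is positive and it equals $1$ (negative $\nu_i$ allowed). Under minimality at $\lambda_0$, $\lambda_0$ is then also a simple eigenvalue of $P(\lambda)$. Definition of $\kappa_S$. Write $A(\lambda)=\sum_{i=0}^{k_A}A_i\lambda^i$, $B(\lambda)=\sum_{i=0}^{k_B}B_i\lambda^i$, $C(\lambda)=\sum_{i=0}^{k_C}C_i\lambda^i$, $D(\lambda)=\sum_{i=0}^{k_D}D_i\lambda^i$, and consider perturbations $\Delta A(\lambda)=\sum_{i=0}^{k_A}\Delta A_i\lambda^i$, $\Delta B(\lambda)=\sum_{i=0}^{k_B}\Delta B_i\lambda^i$, $\Delta C(\lambda)=\sum_{i=0}^{k_C}\Delta C_i\lambda^i$, $\Delta D(\lambda)=\sum_{i=0}^{k_D}\Delta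 D_i\lambda^i$ with complex matrix coefficients of the same sizes, and $\Delta P(\lambda)=\begin{bmatrix}-\Delta A(\lambda)&\Delta B(\lambda)\\ \Delta C(\lambda)&\Delta D(\lambda)\end{bmatrix}$. With $v$ a right eigenvector of $P(\lambda)$ associated with $\lambda_0$, $$\kappa_S(\lambda_0):=\lim_{\epsilon\to0}\sup\Big\{\frac{|\Delta\lambda_0|}{\epsilon}:\ [P(\lambda_0+\Delta\lambda_0)+\epsilon\Delta P(\lambda_0+\Delta\lambda_0)][v+\epsilon\Delta v]=0,\ \|\Delta A_i\|_2\le a_i,\|\Delta B_i\|_2\le b_i,\|\Delta C_i\|_2\le c_i,\|\Delta D_i\|_2\le d_i\Big\},$$ where $\epsilon>0$ and $\lambda_0+\Delta\lambda_0$ denotes the eigenvalue of $P(\lambda)+\epsilon\Delta P(\lambda)$ that arises from perturbing the simple eigenvalue $\lambda_0$, i.e. the unique eigenvalue (for small $\epsilon$) in a fixed small disc around $\lambda_0$ containing no other eigenvalue of $P(\lambda)$, depending analytically on $\epsilon$ and equal to $\lambda_0$ at $\epsilon=0$. Definition of $\kappa_U$. Let $d=\max\{k_A,k_B,k_C,k_D\}$ and $P(\lambda)=\sum_{i=0}^dP_i\lambda^i$. The unstructured absolute condition number, for perturbations $\epsilon\,\Delta P_i$ of the coefficients $P_i$ with $\|\Delta P_i\|_2\le p_i$, is $$\kappa_U(\lambda_0)=\frac{\|w\|_2\|v\|_2\big(\sum_{i=0}^d|\lambda_0|^ip_i\big)}{|w^TP'(\lambda_0)v|},$$ where $v$ and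 $w$ are right and left eigenvectors of $P(\lambda)$ associated with $\lambda_0$ ($P(\lambda_0)v=0$, $w^TP(\lambda_0)=0$, $v,w\ne0$). In the formula for $p_i$, $0\le i\le d$, the weights $a_i,b_i,c_i,d_i$ with index exceeding $k_A,k_B,k_C,k_D$, respectively, are taken to be $0$. *)

(* Defs.v *)
From HB Require Import structures.
From mathcomp Require Export all_boot all_order all_algebra.
From mathcomp Require Export all_classical all_reals all_analysis.
From mathcomp Require Export complex.

Set Implicit Arguments.
Unset Strict Implicit.
Unset Printing Implicit Defensive.

Import Order.TTheory GRing.Theory Num.Theory.
Import numFieldNormedType.Exports.

Local Open Scope classical_set_scope.
Local Open Scope ring_scope.
Local Open Scope complex_scope.

Section PolynomialMatrices.
Variable F : fieldType.

Definition mxeval m q (M : 'M[{poly F}]_(m, q)) (x : F) : 'M[F]_(m, q) :=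
  map_mx (fun f : {poly F} => f.[x]) M.

Definition mxcoef m q (M : 'M[{poly F}]_(m, q)) (i : nat) : 'M[F]_(m, q) :=
  map_mx (fun f : {poly F} => f`_i) M.

Definition mxderiv m q (M : 'M[{poly F}]_(m, q)) : 'M[{poly F}]_(m, q) :=
  map_mx (fun f : {poly F} => f^`()) M.

(* M = \sum_(i <= k) M_i X^i; the coefficient M_k is allowed to vanish. *)
Definition mxdeg_le m q (k : nat) (M : 'M[{poly F}]_(m, q)) : Prop :=
  forall i j, (size (M i j) <= k.+1)%N.

Definition regular_pmx m (M : 'M[{poly F}]_m) : Prop := \det M != 0.

Definition system_mx n p (A : 'M[{poly F}]_n) (B : 'M[{poly F}]_(n, p))
    (C : 'M[{poly F}]_(p, n)) (D : 'M[{poly F}]_p) : 'M[{poly F}]_(n + p) :=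
  block_mx (- A) B C D.

Definition transfer_mx n p (A : 'M[{poly F}]_n) (B : 'M[{poly F}]_(n, p))
    (C : 'M[{poly F}]_(p, n)) (D : 'M[{poly F}]_p)
    : 'M[{fraction {poly F}}]_p :=
  map_mx (@tofrac {poly F}) D +
  map_mx (@tofrac {poly F}) C *m invmx (map_mx (@tofrac {poly F}) A) *m
  map_mx (@tofrac {poly F}) B.

Definition minimal_at n p (A : 'M[{poly F}]_n) (B : 'M[{poly F}]_(n, p))
    (C : 'M[{poly F}]_(p, n)) (x : F) : Prop :=
  \rank (col_mx (- mxeval A x) (mxeval C x)) = n /\
  \rank (row_mx (mxeval A x) (mxeval B x)) = n.

Definition right_eigvec m (M : 'M[{poly F}]_m) (x : F) (v : 'cV[F]_m) : Prop :=
  v != 0 /\ mxeval M x *m v = 0.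

Definition left_eigvec m (M : 'M[{poly F}]_m) (x : F) (w : 'cV[F]_m) : Prop :=
  w != 0 /\ w^T *m mxeval M x = 0.

Definition pmx_eigenvalue m (M : 'M[{poly F}]_m) (x : F) : Prop :=
  exists v, right_eigvec M x v.

End PolynomialMatrices.

Section RationalMatrices.
Variable F : fieldType.

Definition no_pole_at (x : F) (f : {fraction {poly F}}) : Prop :=
  exists a b : {poly F}, b.[x] != 0 /\ f = tofrac a / tofrac b.

(* f has neither a pole nor a zero at x *)
Definition unit_at (x : F) (f : {fraction {poly F}}) : Prop :=
  exists a b : {poly F}, [/\ a.[x] != 0, b.[x] != 0 & f = tofrac a / tofrac b].

Definition invertible_at m (x : F) (G : 'M[{fraction {poly F}}]_m) : Prop :=
  (forall i j, no_pole_at x (G i j)) /\ unit_at x (\det G).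

(* nu is the (nondecreasing) sequence of exponents of the local
   Smith-McMillan form of G at x *)
Definition local_exponents m (x : F) (G : 'M[{fraction {poly F}}]_m)
    (nu : 'I_m -> int) : Prop :=
  (forall i j : 'I_m, (i <= j)%N -> nu i <= nu j) /\
  exists G1 G2 : 'M[{fraction {poly F}}]_m,
    [/\ invertible_at x G1, invertible_at x G2 &
        G1 *m G *m G2 = diag_mx (\row_i (tofrac ('X - x%:P) ^ nu i))].

Definition simple_zero m (x : F) (G : 'M[{fraction {poly F}}]_m) : Prop :=
  exists nu : 'I_m -> int, local_exponents x G nu /\
    exists i, nu i = 1 /\ forall j, j != i -> nu j <= 0.

End RationalMatrices.

Section ConditionNumbers.
Variable R : realType.
Local Notation normc := (@ComplexField.Normc.normc R).

Definition vnorm2 m (x : 'cV[R[i]]_m) : R :=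
  Num.sqrt (\sum_i normc (x i 0) ^+ 2).

Definition mxnorm2 m q (M : 'M[R[i]]_(m, q)) : R :=
  sup [set vnorm2 (M *m x) | x in [set x : 'cV[R[i]]_q | vnorm2 x <= 1]].

(* the perturbation M has degree at most k and coefficients bounded by wt *)
Definition admissible m q (k : nat) (wt : nat -> R)
    (M : 'M[{poly R[i]}]_(m, q)) : Prop :=
  mxdeg_le k M /\ forall i, (i <= k)%N -> mxnorm2 (mxcoef M i) <= wt i.

(* The closed disc of radius r around x contains no eigenvalue of M but,
   possibly, x. *)
Definition isolating_radius m (M : 'M[{poly R[i]}]_m) (x : R[i]) (r : R)
    : Prop :=
  0 < r /\ forall y, pmx_eigenvalue M y -> normc (y - x) <= r -> y = x.

Section Structured.
Variables (n p : nat).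
Variables (A : 'M[{poly R[i]}]_n) (B : 'M[{poly R[i]}]_(n, p))
  (C : 'M[{poly R[i]}]_(p, n)) (D : 'M[{poly R[i]}]_p).
Variables (kA kB kC kD : nat) (a b c d : nat -> R).
Variables (x : R[i]) (v : 'cV[R[i]]_(n + p)) (r : R).

(* The supremum of |dx| / e over admissible perturbations, where x + dx is an
   eigenvalue of P + e dP in the closed disc of radius r around x. When r is
   isolating and x is simple, this eigenvalue is unique for small e: it is the
   one that arises from x. The vector v + e dv is an eigenvector, hence
   nonzero. *)
Definition structured_sup (e : R) : \bar R :=
  ereal_sup [set t : \bar R | exists dx : R[i],
    [/\ t = (normc dx / e)%:E, normc dx <= r &
      exists (dA : 'M[{poly R[i]}]_n) (dB : 'M[{poly R[i]}]_(n, p))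
        (dC : 'M[{poly R[i]}]_(p, n)) (dD : 'M[{poly R[i]}]_p)
        (dv : 'cV[R[i]]_(n + p)),
      [/\ admissible kA a dA, admissible kB b dB, admissible kC c dC,
          admissible kD d dD &
          right_eigvec
            (system_mx A B C D + (e%:C)%:P *: system_mx dA dB dC dD)
            (x + dx) (v + e%:C *: dv)]]].

Definition kappaS : \bar R := lim (structured_sup e @[e --> 0^'+]).

End Structured.

Definition kappaU m (M : 'M[{poly R[i]}]_m) (deg : nat) (wt : nat -> R)
    (x : R[i]) (v w : 'cV[R[i]]_m) : R :=
  vnorm2 w * vnorm2 v * (\sum_(0 <= i < deg.+1) normc x ^+ i * wt i) /
  normc ((w^T *m mxeval (mxderiv M) x *m v) 0 0).

Definition trunc_weight (k : nat) (wt : nat -> R) (i : nat) : R :=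
  if (i <= k)%N then wt i else 0.

Definition block_weight (kA kB kC kD : nat) (a b c d : nat -> R) (i : nat)
    : R :=
  let a' := trunc_weight kA a i in let b' := trunc_weight kB b i in
  let c' := trunc_weight kC c i in let d' := trunc_weight kD d i in
  Num.sqrt (sup [set (a' * y.1 + b' * y.2) ^+ 2 + (c' * y.1 + d' * y.2) ^+ 2
                 | y in [set y : R * R | y.1 ^+ 2 + y.2 ^+ 2 = 1]]).

End ConditionNumbers.

(* Main.v *)
Require Import Defs.
From mathcomp Require Import ring lra.
Import Order.TTheory GRing.Theory Num.Theory.
Import numFieldNormedType.Exports.
Local Open Scope classical_set_scope.
Local Open Scope ring_scope.
Local Open Scope complex_scope.

(** Let P be the system matrix. Under a perturbation e E of P, the simple
    eigenvalue x moves, to first order, with speed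
    k(E) = |w^T E(x) v| / |w^T P'(x) v|. The structured condition number is the
    supremum of k(E) over the admissible E. It is at most kappaU because each
    coefficient satisfies |w^T E_i v| <= |w| |v| p_i: Cauchy-Schwarz, applied to
    the blocks of w, v and E_i, bounds w^T E_i v by the very expression whose
    maximum over the unit circle defines p_i (block_bilinear_le).

    For this picture to hold, x must be a simple root of det P and w^T P'(x) v
    must not vanish, although only the transfer function R is known to have a
    simple zero, possibly along with poles at x. Everything follows from one
    reduction. If P z = (X - x)^k f for polynomial vectors z and f, the full row
    rank of [A(x) B(x)] allows one to modify z, without changing z2(x), so that
    A z1 = B z2 holds exactly; then R z2 = (X - x)^k f2 (system_chain). In the
    local Smith form of R, with a single positive exponent, equal to 1, this
    confines z2(x) to a fixed line for k = 1 and makes it vanish for k = 2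
    (simple_zero_chain). By the full column rank of [-A(x); C(x)], the same is
    true of z(x). So the kernel of P(x) is a line (system_kernel_line) and
    carries no Jordan chain of length two (system_no_double_chain), whence
    system_deriv_neq0 and system_det_simple.

    The limit is obtained from two estimates. Every eigenvalue x + dx of P + e E
    in the isolating disc satisfies | |dx| / e - k(E) | <= c e, with one constant
    c for all the admissible E (first_order); this bounds the suprema from above.
    Conversely, for each E, such an eigenvalue does exist once e is small
    (simple_root_persists), since det (P + e E) has at x a value of order e and a
    slope bounded away from 0; this bounds them from below by each k(E) - c e. *)

Set Implicit Arguments.
Unset Strict Implicit.
Unset Printing Implicit Defensive.

(** * Values of polynomial matrices *)

Section Evaluation.
Variable F : fieldType.
Implicit Types x : F.

Lemma mxevalM m q l (M : 'M[{poly F}]_(m, q)) (N : 'M[{poly F}]_(q, l)) x :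
  mxeval (M *m N) x = mxeval M x *m mxeval N x.
Proof. exact: (map_mxM (horner_eval x)). Qed.

Lemma mxevalD m q (M N : 'M[{poly F}]_(m, q)) x :
  mxeval (M + N) x = mxeval M x + mxeval N x.
Proof. exact: (map_mxD (horner_eval x)). Qed.

Lemma mxevalN m q (M : 'M[{poly F}]_(m, q)) x : mxeval (- M) x = - mxeval M x.
Proof. exact: (map_mxN (horner_eval x)). Qed.

Lemma mxevalZ m q (f : {poly F}) (M : 'M[{poly F}]_(m, q)) x :
  mxeval (f *: M) x = f.[x] *: mxeval M x.
Proof. exact: (map_mxZ (horner_eval x)). Qed.

Lemma mxevalC m q (M : 'M[F]_(m, q)) x : mxeval (map_mx polyC M) x = M.
Proof. by apply/matrixP => i j; rewrite !mxE hornerC. Qed.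

Lemma mxeval_scalar m (f : {poly F}) x : mxeval (f%:M : 'M[{poly F}]_m) x = (f.[x])%:M.
Proof. exact: (map_scalar_mx (horner_eval x)). Qed.

Lemma mxeval_block m1 m2 q1 q2 (A : 'M[{poly F}]_(m1, q1)) (B : 'M[{poly F}]_(m1, q2))
    (C : 'M[{poly F}]_(m2, q1)) (D : 'M[{poly F}]_(m2, q2)) x :
  mxeval (block_mx A B C D) x =
  block_mx (mxeval A x) (mxeval B x) (mxeval C x) (mxeval D x).
Proof. exact: map_block_mx. Qed.

Lemma det_mxeval m (M : 'M[{poly F}]_m) x : \det (mxeval M x) = (\det M).[x].
Proof. exact: (det_map_mx (horner_eval x)). Qed.

Lemma adj_mxeval m (M : 'M[{poly F}]_m) x : \adj (mxeval M x) = mxeval (\adj M) x.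
Proof. by rewrite /mxeval (map_mx_adj (horner_eval x)). Qed.

Lemma mxeval0_factor m q (M : 'M[{poly F}]_(m, q)) x :
  mxeval M x = 0 -> exists N, M = ('X - x%:P) *: N.
Proof.
move=> M0; exists (map_mx (fun f => f %/ ('X - x%:P)) M).
apply/matrixP => i j; rewrite !mxE mulrC divpK // dvdp_XsubCl.
by apply/rootP; move/matrixP/(_ i j): M0; rewrite !mxE.
Qed.

Lemma mxderiv_const m q l (M : 'M[{poly F}]_(m, q)) (v : 'M[F]_(q, l)) :
  mxderiv (M *m map_mx polyC v) = mxderiv M *m map_mx polyC v.
Proof.
apply/matrixP => i j; rewrite !mxE raddf_sum; apply: eq_bigr => k _.
by rewrite !mxE /= derivM derivC mulr0 addr0.
Qed.

(** The product rule, where the term carrying the factor X - x vanishes at x. *)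
Lemma mxeval_deriv_factor m q (M : 'M[{poly F}]_(m, q)) x :
  mxeval (mxderiv (('X - x%:P) *: M)) x = mxeval M x.
Proof.
by apply/matrixP => i j; rewrite !mxE derivM derivXsubC mul1r hornerD hornerM
  hornerXsubC subrr mul0r addr0.
Qed.

Lemma det_eq0_right m (M : 'M[F]_m) :
  reflect (exists2 u : 'cV[F]_m, u != 0 & M *m u = 0) (\det M == 0).
Proof.
rewrite -det_tr; apply: (iffP det0P) => -[u u0 Mu]; exists u^T;
  rewrite ?trmx_eq0 //; apply: trmx_inj.
  by rewrite trmx_mul trmxK Mu trmx0.
by rewrite trmx_mul !trmxK Mu trmx0.
Qed.

Lemma eigenvalue_det m (M : 'M[{poly F}]_m) x :
  pmx_eigenvalue M x <-> (\det M).[x] = 0.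
Proof.
rewrite -det_mxeval; split=> [[u [u0 Mu]]|/eqP/det_eq0_right[u u0 Mu]].
  by apply/eqP/det_eq0_right; exists u.
by exists u.
Qed.

End Evaluation.

(** * Square matrices of corank one *)

Section KernelLine.
Variables (F : fieldType) (m : nat) (M : 'M[F]_m) (v w : 'cV[F]_m).
Hypotheses (kerM : forall u, M *m u = 0 -> exists c, u = c *: v)
  (Mv : M *m v = 0) (v0 : v != 0) (w0 : w != 0) (wM : w^T *m M = 0).

(** The row i of M, redundant as soon as w i <> 0, gives way to the equation
    u j = 0, which excludes the kernel as soon as v j <> 0: the new matrix is
    invertible and turns rank arguments about M into linear systems. *)
Let replaced (i j : 'I_m) : 'M[F]_m :=
  \matrix_(k, l) if k == i then (l == j)%:R else M k l.

Let replacedE i j (u : 'cV[F]_m) k :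
  (replaced i j *m u) k 0 = if k == i then u j 0 else (M *m u) k 0.
Proof.
rewrite !mxE; case: ifP => ki.
  under eq_bigr do rewrite mxE ki.
  rewrite (bigD1 j) //= eqxx mul1r big1 ?addr0 // => l /negPf lj.
  by rewrite lj mul0r.
by apply: eq_bigr => l _; rewrite mxE ki.
Qed.

Let left_eq0 i (b : 'cV[F]_m) : w i 0 != 0 -> w^T *m b = 0 ->
  (forall k, k != i -> b k 0 = 0) -> b = 0.
Proof.
move=> wi wb bk; apply/matrixP => k l; rewrite (ord1 l) mxE {l}.
have [->|/bk//] := eqVneq k i.
move/matrixP/(_ 0 0): wb; rewrite !mxE (bigD1 i) //= big1 ?addr0 => [|l li].
  by move/eqP; rewrite mulf_eq0 mxE (negPf wi) => /eqP.
by rewrite bk // mulr0.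
Qed.

Let nz_entry (u : 'cV[F]_m) : u != 0 -> exists i, u i 0 != 0.
Proof.
by move=> /matrix0Pn[i [j]]; rewrite (ord1 j) => ui; exists i.
Qed.

Let replaced_unit i j : w i 0 != 0 -> v j 0 != 0 -> \det (replaced i j) != 0.
Proof.
move=> wi vj; apply/negP => /det_eq0_right[u u0 Mu].
have Muk k : (replaced i j *m u) k 0 = 0 by rewrite Mu mxE.
have Mu0 : M *m u = 0.
  apply: (left_eq0 wi); first by rewrite mulmxA wM mul0mx.
  by move=> k ki; move: (Muk k); rewrite replacedE (negPf ki).
have [c uE] := kerM Mu0.
move: (Muk i); rewrite replacedE eqxx uE mxE => /eqP.
rewrite mulf_eq0 (negPf vj) orbF => /eqP c0.
by move: u0; rewrite uE c0 scale0r eqxx.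
Qed.

(** Expanding the determinant of the modified matrix along its replaced row
    leaves one cofactor, which is also a cofactor of M. *)
Lemma kernel_line_adj_neq0 : \adj M != 0.
Proof.
have [[i wi] [j vj]] := (nz_entry w0, nz_entry v0).
apply/negP => /eqP adj0; have := replaced_unit wi vj.
rewrite (expand_det_row _ i) (bigD1 j) //= mxE !eqxx mul1r big1 ?addr0.
  have -> : cofactor (replaced i j) i j = (\adj M) j i.
    rewrite mxE /cofactor; congr (_ * \det _); apply/matrixP => k l.
    by rewrite !mxE eq_sym (negPf (neq_lift _ _)).
  by rewrite adj0 mxE eqxx.
by move=> l /negPf lj; rewrite mxE eqxx lj mul0r.
Qed.

(** It suffices to solve the equations other than the i-th, which the modified
    matrix does: w is orthogonal to the residual M u - b and has a nonzero i-th
    entry, so the i-th equation follows. *)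
Lemma left_orthogonal_solvable (b : 'cV[F]_m) :
  w^T *m b = 0 -> exists u : 'cV[F]_m, M *m u = b.
Proof.
move=> wb; have [[i wi] [j vj]] := (nz_entry w0, nz_entry v0).
have U : replaced i j \in unitmx by rewrite unitmxE unitfE replaced_unit.
exists (invmx (replaced i j) *m b).
apply/eqP; rewrite -subr_eq0; apply/eqP/(left_eq0 wi).
  by rewrite mulmxBr wb subr0 mulmxA wM mul0mx.
move=> k ki; have := replacedE i j (invmx (replaced i j) *m b) k.
by rewrite (negPf ki) mulmxA mulmxV // mul1mx !mxE => ->; rewrite subrr.
Qed.

(** The equations of M determine a vector up to its component along the kernel,
    so the rest is recovered linearly from M u. This splits an approximate
    eigenvector into a multiple of v and a remainder as small as M u. With R the
    modified matrix, R u agrees with M u outside row i, and v is a multiple of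
    the preimage under R of the i-th unit vector. *)
Lemma kernel_line_left_inverse :
  exists (L : 'M[F]_m) (phi : 'cV[F]_m -> F),
    forall u, u = phi u *: v + L *m (M *m u).
Proof.
have [[i wi] [j vj]] := (nz_entry w0, nz_entry v0).
have U : replaced i j \in unitmx by rewrite unitmxE unitfE replaced_unit.
have Rdelta (u : 'cV[F]_m) :
    replaced i j *m u = u j 0 *: delta_mx i 0 + (1%:M - delta_mx i i) *m (M *m u).
  apply/matrixP => k l; rewrite (ord1 l) replacedE mulmxBl mul1mx [RHS]mxE.
  rewrite [X in X + _]mxE [X in _ + X]mxE [X in _ + (_ + X)]mxE.
  rewrite [X in _ + (_ - X)]mxE (bigD1 i) //= big1 => [|l' /negPf li].
    move: (M *m u) => b; rewrite !mxE eqxx !andbT.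
    have [->|ki] := eqVneq k i; first by rewrite ?eqxx ?mulr1 ?mul1r ?addr0 subrr addr0.
    by rewrite ?mulr0 ?mul0r ?addr0 ?subr0 ?add0r.
  by rewrite mxE li andbF mul0r.
have viE : v = v j 0 *: (invmx (replaced i j) *m delta_mx i 0).
  by rewrite scalemxAr -[LHS](mulKmx U) Rdelta Mv mulmx0 addr0.
exists (invmx (replaced i j) *m (1%:M - delta_mx i i)), (fun u => u j 0 / v j 0).
move=> u; rewrite [X in _ *: X]viE scalerA divfK // -mulmxA scalemxAr -mulmxDr -Rdelta.
by rewrite mulKmx.
Qed.

End KernelLine.

(** * The local Smith form at a simple zero *)

Section LocalSmithForm.
Variable F : fieldType.
Local Notation frac := (@tofrac {poly F}).

(** The product of all the denominators clears them; it does not vanish at x, so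
    the determinant stays nonzero at x. This moves the local Smith form from
    rational functions to polynomial matrices, which can be evaluated. *)
Lemma clear_denominators m x (G : 'M[{fraction {poly F}}]_m) :
  invertible_at x G -> exists (g : {poly F}) (H : 'M[{poly F}]_m),
    [/\ g.[x] != 0, frac g *: G = map_mx frac H & (\det H).[x] != 0].
Proof.
case=> npG [c [e [cx ex detG]]].
pose pr (f : {fraction {poly F}}) (ab : {poly F} * {poly F}) :=
  ab.2.[x] != 0 /\ f = frac ab.1 / frac ab.2.
have /choice[f fP] : forall ij : 'I_m * 'I_m, exists ab, pr (G ij.1 ij.2) ab.
  by case=> i j; have [a [b [bx Gij]]] := npG i j; exists (a, b).
pose g := \prod_ij (f ij).2.
have gx : g.[x] != 0.
  by rewrite horner_prod; apply/prodf_neq0 => ij _; case: (fP ij).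
pose H := \matrix_(i, j) ((f (i, j)).1 * \prod_(ij | ij != (i, j)) (f ij).2).
have gG : frac g *: G = map_mx frac H.
  apply/matrixP => i j; rewrite !mxE [g](bigD1 (i, j)) //= !rmorphM /=.
  have [bx ->] := fP (i, j); rewrite mulrC mulrA divfK //.
  rewrite tofrac_eq0; apply: contraNneq bx => ->; by rewrite horner0.
exists g, H; split=> //.
have e0 : e != 0 by apply: contraNneq ex => ->; rewrite horner0.
have eq1 : g ^+ m * c = \det H * e.
  apply/eqP; rewrite -tofrac_eq !rmorphM /= rmorphXn /= -det_map_mx -gG detZ detG.
  by rewrite -!mulrA mulVf ?mulr1 // tofrac_eq0.
have : (g ^+ m * c).[x] != 0 by rewrite hornerM horner_exp mulf_neq0 ?expf_neq0.
by rewrite eq1 hornerM mulf_eq0 => /norP[].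
Qed.

(** In the Smith coordinates y = adj(H2) z the equation G z = (X - x)^k f splits
    into (X - x)^(nu i) y i = (X - x)^k q i, up to factors nonzero at x. If
    nu i <= 0 < k, then y i vanishes at x; for the exponent 1 this needs k > 1.
    The matrix H of the conclusion is the value of adj(H2) at x. *)
Lemma simple_zero_chain m x (G : 'M[{fraction {poly F}}]_m) :
  simple_zero x G -> exists (H : 'M[F]_m) (i0 : 'I_m),
    (forall u : 'cV[F]_m, H *m u = 0 -> u = 0) /\
    forall k (z f : 'cV[{poly F}]_m),
      G *m map_mx frac z = map_mx frac (('X - x%:P) ^+ k *: f) ->
      ((0 < k)%N -> forall i, i != i0 -> (H *m mxeval z x) i 0 = 0) /\
      ((1 < k)%N -> mxeval z x = 0).
Proof.
case=> nu [[_ [G1 [G2 [inv1 inv2 smith]]]] [i0 [nui0 nuj]]].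
have [g1 [H1 [g1x gG1 _]]] := clear_denominators inv1.
have [g2 [H2 [g2x gG2 dH2]]] := clear_denominators inv2.
exists (mxeval (\adj H2) x), i0.
have inj (u : 'cV[F]_m) : mxeval (\adj H2) x *m u = 0 -> u = 0.
  move=> /(congr1 (mulmx (mxeval H2 x))); rewrite mulmx0 mulmxA -mxevalM.
  rewrite mul_mx_adj mxeval_scalar mul_scalar_mx => /eqP.
  by rewrite scaler_eq0 (negPf dH2) => /eqP.
split=> // k z f Gz; pose s := 'X - x%:P; pose y := \adj H2 *m z.
have s0 : frac s != 0 by rewrite tofrac_eq0 polyXsubC_eq0.
pose q := \det H2 *: (H1 *m f).
have key i : frac (g1 * g2 * y i 0) * frac s ^ nu i = frac (s ^+ k * q i 0).
  have : map_mx frac H1 *m G *m map_mx frac H2 *m map_mx frac y =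
         map_mx frac (s ^+ k *: q).
    rewrite -!mulmxA -map_mxM [H2 *m y]mulmxA mul_mx_adj mul_scalar_mx map_mxZ /=.
    rewrite -scalemxAr Gz -scalemxAr -map_mxM -map_mxZ; congr (map_mx _ _).
    by rewrite /q -scalemxAr !scalerA mulrC.
  rewrite -gG1 -gG2 -!scalemxAl -!scalemxAr -!scalemxAl scalerA smith.
  move/matrixP/(_ i 0); rewrite mul_diag_mx !mxE !rmorphM /= => <-.
  by rewrite !mulrA mulrAC.
have yx i : mxeval y x i 0 = (mxeval (\adj H2) x *m mxeval z x) i 0.
  by rewrite mxevalM.
(* a nonpositive exponent is moved to the other side *)
have nonpole i : nu i <= 0 -> (0 < k)%N -> (mxeval y x) i 0 = 0.
  move=> nui k0; have := key i; have -> : nu i = - (`|nu i|%N : int).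
    by rewrite abszE ler0_norm ?opprK.
  rewrite -exprnN => /(congr1 (fun t => t * frac s ^+ `|nu i|)).
  rewrite divfK ?expf_neq0 // -rmorphXn -rmorphM => /eqP; rewrite tofrac_eq => /eqP.
  move=> /(congr1 (fun h => h.[x])); rewrite !hornerM horner_exp hornerXsubC subrr.
  rewrite (expr0n _ k) (gtn_eqF k0) !mul0r => /eqP; rewrite !mulf_eq0 (negPf g1x) (negPf g2x).
  by move=> /= /eqP <-; rewrite [LHS]mxE.
split=> [k0 i ii0|k1]; first by rewrite -yx; apply: nonpole => //; apply: nuj.
apply: inj; apply/matrixP => i j; rewrite (ord1 j) -yx [RHS]mxE.
have [->{i}|ii0] := eqVneq i i0; last by apply: nonpole; rewrite ?nuj ?(ltnW k1).
have := key i0; rewrite nui0 expr1z -rmorphM => /eqP; rewrite tofrac_eq => /eqP.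
rewrite -(prednK (ltnW k1)) exprSr [RHS]mulrAC => /mulIf.
rewrite polyXsubC_eq0 => /(_ isT) /(congr1 (fun h => h.[x])).
have k2 : (k.-1 == 0)%N = false by rewrite -subn1 subn_eq0 leqNgt k1.
rewrite !hornerM horner_exp hornerXsubC subrr (expr0n _ k.-1) k2 mul0r => /eqP.
rewrite !mulf_eq0 (negPf g1x) (negPf g2x).
by move=> /= /eqP <-; rewrite [LHS]mxE.
Qed.
End LocalSmithForm.

(** * Simplicity of the eigenvalue of the system matrix *)

Section SystemMatrix.
Variables (F : fieldType) (n p : nat).
Variables (A : 'M[{poly F}]_n) (B : 'M[{poly F}]_(n, p))
  (C : 'M[{poly F}]_(p, n)) (D : 'M[{poly F}]_p) (x : F).
Hypotheses (regA : regular_pmx A) (simple_x : simple_zero x (transfer_mx A B C D))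
  (min_x : minimal_at A B C x).
Local Notation P := (system_mx A B C D).
Local Notation frac := (@tofrac {poly F}).

(** A constant right inverse of [A(x) B(x)] gives A X0 + B Y0 invertible at x;
    multiplying by the adjugate makes this sum scalar, with value 1 at x. *)
Lemma minimal_bezout : exists (X : 'M[{poly F}]_n) (Y : 'M[{poly F}]_(p, n)) mu,
  A *m X + B *m Y = mu%:M /\ mu.[x] = 1.
Proof.
have /row_freeP[E] : row_free (row_mx (mxeval A x) (mxeval B x)).
  by rewrite /row_free min_x.2.
rewrite -[E]vsubmxK mul_row_col => E1.
pose X0 := map_mx polyC (usubmx E); pose Y0 := map_mx polyC (dsubmx E).
pose M := A *m X0 + B *m Y0.
exists (X0 *m \adj M), (Y0 *m \adj M), (\det M); split.
  by rewrite !mulmxA -mulmxDl mul_mx_adj.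
by rewrite -det_mxeval mxevalD !mxevalM !mxevalC E1 det1.
Qed.

Lemma transfer_kernel (z1 : 'cV[{poly F}]_n) (z2 f : 'cV[{poly F}]_p) :
  A *m z1 = B *m z2 -> C *m z1 + D *m z2 = f ->
  transfer_mx A B C D *m map_mx frac z2 = map_mx frac f.
Proof.
have Au : map_mx frac A \in unitmx by rewrite unitmxE unitfE det_map_mx tofrac_eq0.
move=> Az <-; rewrite /transfer_mx mulmxDl -!mulmxA -(map_mxM _ B) -Az map_mxM.
by rewrite (mulKmx Au) map_mxD !map_mxM addrC.
Qed.

(** The first block row of the equation is made exact: subtracting
    (X - x)^k (X f1, Y f1) cancels its right-hand side by the Bezout identity,
    and changes neither z2(x) nor, modulo (X - x)^k, the second block row. What
    remains is an equation for the transfer function alone. *)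
Lemma system_chain k (z f : 'cV[{poly F}]_(n + p)) :
  P *m z = ('X - x%:P) ^+ k *: f -> (0 < k)%N ->
  exists z2 f2 : 'cV[{poly F}]_p,
    mxeval z2 x = mxeval (dsubmx z) x /\
    transfer_mx A B C D *m map_mx frac z2 = map_mx frac (('X - x%:P) ^+ k *: f2).
Proof.
set s := 'X - x%:P => Pz k0; have [X [Y [mu [XY mux]]]] := minimal_bezout.
have [z1E z2E] : - A *m usubmx z + B *m dsubmx z = s ^+ k *: usubmx f /\
    C *m usubmx z + D *m dsubmx z = s ^+ k *: dsubmx f.
  by apply: eq_col_mx; rewrite -mul_block_col vsubmxK Pz -scale_col_mx vsubmxK.
pose z1' := mu *: usubmx z + s ^+ k *: (X *m usubmx f).
pose z2' := mu *: dsubmx z - s ^+ k *: (Y *m usubmx f).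
exists z2', (mu *: dsubmx f + C *m (X *m usubmx f) - D *m (Y *m usubmx f)); split.
  rewrite mxevalD mxevalN !mxevalZ mux scale1r horner_exp hornerXsubC subrr.
  by rewrite (expr0n _ k) (gtn_eqF k0) scale0r subr0.
apply: (@transfer_kernel z1').
  apply/eqP; rewrite -subr_eq0 /z1' /z2' !mulmxDr mulmxN -!scalemxAr !mulmxA.
  have -> : A *m usubmx z = B *m dsubmx z - s ^+ k *: usubmx f.
    by rewrite -z1E mulNmx opprD opprK addrCA subrr addr0.
  have -> : A *m X *m usubmx f = mu *: usubmx f - B *m Y *m usubmx f.
    by rewrite -mul_scalar_mx -XY mulmxDl addrK.
  by rewrite !scalerBr !scalerA [mu * _]mulrC addrA subrK subrr.
rewrite /z1' /z2' !mulmxDr mulmxN -!scalemxAr.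
rewrite addrACA -scalerDr z2E scalerA [mu * _]mulrC -scalerA.
by rewrite -scalerBr -scalerDr addrA.
Qed.

(** This is where the full column rank of [-A(x); C(x)] enters: a kernel vector
    is determined by its second block. *)
Lemma system_kernel_eq0 (u : 'cV[F]_(n + p)) :
  mxeval P x *m u = 0 -> dsubmx u = 0 -> u = 0.
Proof.
rewrite mxeval_block mxevalN -{1 3}[u]vsubmxK mul_block_col => Pu u2.
rewrite u2 !mulmx0 !addr0 -mul_col_mx in Pu *.
have /row_fullP[E E1] : row_full (col_mx (- mxeval A x) (mxeval C x)).
  by rewrite /row_full min_x.1.
by rewrite -[usubmx u]mul1mx -E1 -mulmxA Pu mulmx0 col_mx0.
Qed.

Lemma mxeval_dsubmx (z : 'cV[{poly F}]_(n + p)) :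
  mxeval (dsubmx z) x = dsubmx (mxeval z x).
Proof. by apply/matrixP => i j; rewrite !mxE. Qed.

(** For k = 2 the reduction to the transfer function forces z2(x) = 0, and z(x)
    lies in the kernel of P(x). In other words, no Jordan chain at x has length
    two. *)
Lemma system_no_double_chain (z f : 'cV[{poly F}]_(n + p)) :
  P *m z = ('X - x%:P) ^+ 2 *: f -> mxeval z x = 0.
Proof.
move=> Pz; have [H [i0 [_ chain]]] := simple_zero_chain simple_x.
have [//|z2 [f2 [z2x Rz2]]] := system_chain Pz.
apply: system_kernel_eq0; last first.
  by rewrite -mxeval_dsubmx -z2x; have [_ ->] := chain _ _ _ Rz2.
rewrite -mxevalM Pz mxevalZ horner_exp hornerXsubC subrr.
by rewrite expr0n scale0r.
Qed.

Lemma system_kernel_line (v u : 'cV[F]_(n + p)) : v != 0 ->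
  mxeval P x *m v = 0 -> mxeval P x *m u = 0 -> exists c, u = c *: v.
Proof.
move=> v0 Pv Pu; have [H [i0 [injH chain]]] := simple_zero_chain simple_x.
have ker i (y : 'cV[F]_(n + p)) : mxeval P x *m y = 0 -> i != i0 ->
    (H *m dsubmx y) i 0 = 0.
  move=> Py ii0; have [f Pf] : exists f, P *m map_mx polyC y = ('X - x%:P) ^+ 1 *: f.
    by apply: mxeval0_factor; rewrite mxevalM mxevalC.
  have [//|z2 [f2 [z2x Rz2]]] := system_chain Pf.
  by have [/(_ isT i ii0) + _] := chain _ _ _ Rz2; rewrite z2x mxeval_dsubmx mxevalC.
pose e (y : 'cV[F]_(n + p)) := (H *m dsubmx y) i0 0.
have ev0 : e v != 0.
  apply: contraNneq v0 => ev; apply/eqP/system_kernel_eq0 => //; apply: injH.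
  apply/matrixP => i j; rewrite (ord1 j) [RHS]mxE.
  by have [->|ii0] := eqVneq i i0; [exact: ev | exact: ker].
exists (e u / e v); apply/eqP; rewrite -subr_eq0; apply/eqP/system_kernel_eq0.
  by rewrite mulmxBr -scalemxAr Pu Pv scaler0 subr0.
apply: injH; rewrite linearB linearZ /= mulmxBr -scalemxAr.
apply/matrixP => i j; rewrite (ord1 j) [RHS]mxE [LHS]mxE [X in _ + X]mxE.
rewrite [X in _ - X]mxE; have [->|ii0] := eqVneq i i0.
  by rewrite -/(e u) -/(e v) divfK ?subrr.
by rewrite !ker // mulr0 subrr.
Qed.

(** If w^T P'(x) v = 0, then P(x) u = - P'(x) v has a solution u, and
    v + (X - x) u is a Jordan chain of length two starting at v <> 0. *)
Lemma system_deriv_neq0 (v w : 'cV[F]_(n + p)) :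
  right_eigvec P x v -> left_eigvec P x w ->
  w^T *m mxeval (mxderiv P) x *m v != 0.
Proof.
move=> [v0 Pv] [w0 wP]; apply: contraNneq (v0) => wPv; apply/eqP.
have [f Pf] : exists f, P *m map_mx polyC v = ('X - x%:P) *: f.
  by apply: mxeval0_factor; rewrite mxevalM mxevalC.
have fx : mxeval f x = mxeval (mxderiv P) x *m v.
  by rewrite -mxeval_deriv_factor -Pf mxderiv_const mxevalM mxevalC.
have kl u := @system_kernel_line v u v0 Pv.
have [u Pu] : exists u, mxeval P x *m u = - mxeval f x.
  by apply: (left_orthogonal_solvable kl v0 w0 wP); rewrite mulmxN fx mulmxA wPv oppr0.
have [h Ph] : exists h, f + P *m map_mx polyC u = ('X - x%:P) *: h.
  by apply: mxeval0_factor; rewrite mxevalD mxevalM mxevalC Pu subrr.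
have := @system_no_double_chain (map_mx polyC v + ('X - x%:P) *: map_mx polyC u) h.
rewrite mulmxDr -scalemxAr Pf -scalerDr Ph scalerA => /(_ erefl).
by rewrite mxevalD mxevalZ !mxevalC hornerXsubC subrr scale0r addr0.
Qed.

(** If (X - x)^2 divides det P, then P adj(P) = det P makes each column of adj(P)
    a Jordan chain of length two, so adj(P(x)) = 0; but P(x) has corank one. *)
Lemma system_det_simple (v w : 'cV[F]_(n + p)) :
  right_eigvec P x v -> left_eigvec P x w ->
  exists h, \det P = ('X - x%:P) * h /\ h.[x] != 0.
Proof.
move=> [v0 Pv] [w0 wP]; have kl u := @system_kernel_line v u v0 Pv.
have adj0 := kernel_line_adj_neq0 kl v0 w0 wP.
have [h gE] : exists h, \det P = h * ('X - x%:P).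
  by apply/factor_theorem/rootP/eigenvalue_det; exists v.
exists h; rewrite mulrC; split=> //; apply: contraNneq (adj0) => /eqP/factor_theorem.
move=> [h1 hE]; rewrite adj_mxeval; apply/eqP/matrixP => i j.
have Pz : P *m col j (\adj P) = ('X - x%:P) ^+ 2 *: (h1 *: delta_mx j 0).
  by rewrite colE mulmxA mul_mx_adj gE hE mul_scalar_mx scalerA -mulrA mulrC expr2.
by have /matrixP/(_ i 0) := system_no_double_chain Pz; rewrite !mxE.
Qed.

End SystemMatrix.

(** * Estimates for polynomial matrices on a disc *)

Section Modulus.
Variable R : realType.
Local Notation F := R[i].
Local Notation normc := (@ComplexField.Normc.normc R).

Lemma normc_ge0 (z : F) : 0 <= normc z.
Proof. by case: z => a b; exact: sqrtr_ge0. Qed.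

Lemma normcD (y z : F) : normc (y + z) <= normc y + normc z.
Proof. exact: le_normcD. Qed.

Lemma normcNE (z : F) : normc (- z) = normc z.
Proof. exact: normcN. Qed.

Lemma normcM (y z : F) : normc (y * z) = normc y * normc z.
Proof. exact: ComplexField.Normc.normcM. Qed.

Lemma normc0 : normc 0 = 0.
Proof. exact: ComplexField.Normc.normc0. Qed.

Lemma normc_gt0 (z : F) : (0 < normc z) = (z != 0).
Proof.
rewrite lt_neqAle normc_ge0 andbT eq_sym; congr (~~ _).
by apply/eqP/eqP => [/ComplexField.Normc.eq0_normc //|->]; exact: normc0.
Qed.

Lemma normcX (z : F) k : normc (z ^+ k) = normc z ^+ k.
Proof.
by elim: k => [|k IH]; rewrite ?expr0 ?ComplexField.Normc.normc1 // !exprS normcM IH.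
Qed.

Lemma normc_real (e : R) : normc e%:C = `|e|.
Proof. by rewrite /ComplexField.Normc.normc /= expr0n addr0 sqrtr_sqr. Qed.

Lemma normc_sum I (s : seq I) (Q : pred I) (f : I -> F) :
  normc (\sum_(i <- s | Q i) f i) <= \sum_(i <- s | Q i) normc (f i).
Proof.
elim/big_ind2: _ => [|a b c d ab cd|//]; first by rewrite normc0.
exact: le_trans (normcD _ _) (lerD ab cd).
Qed.

Lemma normcB_ge (y z : F) : `|normc y - normc z| <= normc (y + z).
Proof.
have := normcD (y + z) (- z); have := normcD (y + z) (- y).
rewrite addrK [y + z]addrC addrK !normcNE => ? ?; rewrite ler_norml; lra.
Qed.

(** This norm is submultiplicative and bounds each entry, which makes the
    remainder estimates elementary. *)
Definition l1norm m q (M : 'M[F]_(m, q)) : R := \sum_i \sum_j normc (M i j).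

Lemma l1norm_ge0 m q (M : 'M[F]_(m, q)) : 0 <= l1norm M.
Proof. by do 2![apply: sumr_ge0 => ? _]; exact: normc_ge0. Qed.

Lemma l1normD m q (M N : 'M[F]_(m, q)) : l1norm (M + N) <= l1norm M + l1norm N.
Proof.
rewrite -big_split; apply: ler_sum => i _; rewrite -big_split; apply: ler_sum => j _.
by rewrite mxE; exact: normcD.
Qed.

Lemma l1normN m q (M : 'M[F]_(m, q)) : l1norm (- M) = l1norm M.
Proof. by do 2![apply: eq_bigr => ? _]; rewrite mxE normcNE. Qed.

Lemma l1norm0 m q : l1norm (0 : 'M[F]_(m, q)) = 0.
Proof. by do 2![apply: big1 => ? _]; rewrite mxE normc0. Qed.

Lemma l1normZ m q z (M : 'M[F]_(m, q)) : l1norm (z *: M) = normc z * l1norm M.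
Proof.
rewrite mulr_sumr; apply: eq_bigr => i _; rewrite mulr_sumr.
by apply: eq_bigr => j _; rewrite mxE normcM.
Qed.

Lemma l1norm_sum I (s : seq I) m q (f : I -> 'M[F]_(m, q)) :
  l1norm (\sum_(i <- s) f i) <= \sum_(i <- s) l1norm (f i).
Proof.
elim/big_ind2: _ => [|a b c d ab cd|//]; first by rewrite l1norm0.
exact: le_trans (l1normD _ _) (lerD ab cd).
Qed.

Lemma l1norm_entry m q (M : 'M[F]_(m, q)) i j : normc (M i j) <= l1norm M.
Proof.
rewrite /l1norm (bigD1 i) //= (bigD1 j) //= -addrA lerDl addr_ge0 //.
  by apply: sumr_ge0 => ? _; exact: normc_ge0.
by do 2![apply: sumr_ge0 => ? _]; exact: normc_ge0.
Qed.

Lemma l1norm_gt0 m q (M : 'M[F]_(m, q)) : M != 0 -> 0 < l1norm M.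
Proof.
move=> /matrix0Pn[i [j Mij]]; apply: lt_le_trans (l1norm_entry M i j).
by rewrite normc_gt0.
Qed.

Lemma l1normM m q l (M : 'M[F]_(m, q)) (N : 'M[F]_(q, l)) :
  l1norm (M *m N) <= l1norm M * l1norm N.
Proof.
rewrite mulr_suml; apply: ler_sum => i _.
apply: (@le_trans _ _ (\sum_j \sum_k normc (M i k) * normc (N k j))).
  apply: ler_sum => j _; rewrite mxE; apply: le_trans (normc_sum _ _ _) _.
  by apply: ler_sum => k _; rewrite normcM.
rewrite exchange_big mulr_suml; apply: ler_sum => k _; rewrite -mulr_sumr.
rewrite ler_wpM2l ?normc_ge0 // /l1norm (bigD1 k) //= lerDl.
by do 2![apply: sumr_ge0 => ? _]; exact: normc_ge0.
Qed.

Lemma l1norm_bound (T : Type) (Q : T -> Prop) (t : T -> R) m q (M : T -> 'M[F]_(m, q)) :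
  (forall i j, exists c, 0 <= c /\ forall y, Q y -> normc (M y i j) <= c * t y) ->
  exists c, 0 <= c /\ forall y, Q y -> l1norm (M y) <= c * t y.
Proof.
move=> H; have /choice[c cP] : forall ij : 'I_m * 'I_q, exists c,
    0 <= c /\ forall y, Q y -> normc (M y ij.1 ij.2) <= c * t y by case.
exists (\sum_i \sum_j c (i, j)); split.
  by do 2![apply: sumr_ge0 => ? _]; exact: (cP _).1.
move=> y Qy; rewrite mulr_suml; apply: ler_sum => i _.
by rewrite mulr_suml; apply: ler_sum => j _; exact: ((cP (i, j)).2 y Qy).
Qed.

Variables (x : F) (r : R).
Let disc (z : F) := normc z <= r.

Lemma normc_disc z : disc z -> normc (x + z) <= normc x + r.
Proof. by move=> ?; apply: le_trans (normcD _ _) _; rewrite lerD2l. Qed.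

Lemma poly_bound (f : {poly F}) :
  exists c, 0 <= c /\ forall z, disc z -> normc f.[x + z] <= c.
Proof.
elim/poly_ind: f => [|f a [c [c0 fc]]].
  by exists 0; split=> // z _; rewrite horner0 normc0.
exists (c * Num.max 0 (normc x + r) + normc a); split.
  by rewrite addr_ge0 ?mulr_ge0 ?normc_ge0 // le_max lexx.
move=> z dz; rewrite hornerMXaddC; apply: le_trans (normcD _ _) _.
rewrite lerD2r normcM ler_pM ?normc_ge0 ?fc //.
by rewrite le_max normc_disc ?orbT.
Qed.

(** With f = f1 X + a, the remainder of f is (x + z) times the remainder of f1,
    plus z^2 f1'(x). *)
Lemma poly_taylor_bound (f : {poly F}) :
  exists c, 0 <= c /\ forall z, disc z ->
    normc (f.[x + z] - f.[x] - z * f^`().[x]) <= c * normc z ^+ 2.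
Proof.
elim/poly_ind: f => [|f a [c [c0 fc]]].
  exists 0; split=> // z _; rewrite deriv0 !horner0 mulr0 !subr0 mul0r.
  by rewrite normc0.
exists (c * Num.max 0 (normc x + r) + normc f^`().[x]); split.
  by rewrite addr_ge0 ?mulr_ge0 ?normc_ge0 // le_max lexx.
move=> z dz; rewrite derivD derivM derivX derivC addr0 mulr1.
rewrite !hornerD !hornerM !hornerX !hornerC.
set u := f.[x + z] in fc *; set u0 := f.[x] in fc *; set u1 := f^`().[x] in fc *.
have -> : u * (x + z) + a - (u0 * x + a) - z * (u1 * x + u0) =
  (u - u0 - z * u1) * (x + z) + z * z * u1 by ring.
apply: le_trans (normcD _ _) _; rewrite !normcM mulrDl; apply: lerD.
  rewrite mulrAC; apply: ler_pM; rewrite ?normc_ge0 ?fc //.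
  by rewrite le_max normc_disc ?orbT.
by rewrite -expr2 mulrC.
Qed.

Lemma mxeval_bound m q (M : 'M[{poly F}]_(m, q)) :
  exists c, 0 <= c /\ forall z, disc z -> l1norm (mxeval M (x + z)) <= c.
Proof.
have [|c [c0 cP]] := @l1norm_bound _ disc (fun=> 1) m q (fun z => mxeval M (x + z)).
  move=> i j; have [c [c0 fc]] := poly_bound (M i j).
  by exists c; split=> // z dz; rewrite mxE mulr1 fc.
by exists c; split=> // z /cP; rewrite mulr1.
Qed.

Lemma mxeval_taylor_bound m q (M : 'M[{poly F}]_(m, q)) :
  exists c, 0 <= c /\ forall z, disc z ->
   l1norm (mxeval M (x + z) - mxeval M x - z *: mxeval (mxderiv M) x)
     <= c * normc z ^+ 2.
Proof.
apply: (@l1norm_bound _ disc (fun z => normc z ^+ 2)) => i j.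
have [c [c0 fc]] := poly_taylor_bound (M i j).
by exists c; split=> // z dz; rewrite !mxE fc.
Qed.

Lemma mxeval_coef k m q (M : 'M[{poly F}]_(m, q)) y : mxdeg_le k M ->
  mxeval M y = \sum_(i < k.+1) y ^+ i *: mxcoef M i.
Proof.
move=> dM; apply/matrixP => i j; rewrite !mxE summxE (horner_coef_wide y (dM i j)).
by apply: eq_bigr => l _; rewrite !mxE mulrC.
Qed.

Lemma normc_exp_sub z k : disc z ->
  normc ((x + z) ^+ k - x ^+ k) <= (k%:R * (1 + normc x + r) ^+ k) * normc z.
Proof.
move=> dz; have r0 : 0 <= r := le_trans (normc_ge0 z) dz.
have x0 := normc_ge0 x; have z0 := normc_ge0 z.
elim: k => [|k IH]; first by rewrite subrr normc0 !mul0r.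
set q := 1 + normc x + r in IH *; have q1 : 1 <= q by rewrite /q; lra.
have -> : (x + z) ^+ k.+1 - x ^+ k.+1 =
  (x + z) * ((x + z) ^+ k - x ^+ k) + z * x ^+ k by rewrite !exprS; ring.
apply: le_trans (normcD _ _) _; rewrite !normcM normcX.
have xz : normc (x + z) <= q by apply: le_trans (normc_disc dz) _; rewrite /q; lra.
have h1 : normc (x + z) * normc ((x + z) ^+ k - x ^+ k) <=
    q * (k%:R * q ^+ k * normc z) by apply: ler_pM; rewrite ?normc_ge0.
have h2 : normc z * normc x ^+ k <= normc z * q ^+ k.+1.
  rewrite ler_wpM2l //; apply: (@le_trans _ _ (q ^+ k)).
    by rewrite lerXn2r ?nnegrE // /q; lra.
  by rewrite exprS ler_peMl // exprn_ge0 //; lra.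
apply: le_trans (lerD h1 h2) _; rewrite le_eqVlt; apply/orP; left; apply/eqP.
by rewrite -natr1 exprS; ring.
Qed.

(** The constant depends on the bounds on degree and coefficients only, so that
    all the admissible perturbations are estimated at once. *)
Lemma mxeval_uniform_bound k W m q : exists c, forall M : 'M[{poly F}]_(m, q),
  mxdeg_le k M -> (forall i, (i <= k)%N -> l1norm (mxcoef M i) <= W) ->
  forall z, disc z -> l1norm (mxeval M (x + z)) <= c /\
    l1norm (mxeval M (x + z) - mxeval M x) <= c * normc z.
Proof.
pose c1 := \sum_(i < k.+1) (1 + normc x + r) ^+ i * W.
pose c2 := \sum_(i < k.+1) i%:R * (1 + normc x + r) ^+ i * W.
exists (Num.max c1 c2) => M dM MW z dz.
have r0 : 0 <= r := le_trans (normc_ge0 z) dz.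
have x0 := normc_ge0 x; have z0 := normc_ge0 z.
rewrite !(mxeval_coef _ dM); split.
  apply: (@le_trans _ _ c1); last by rewrite le_max lexx.
  apply: le_trans (l1norm_sum _ _) _; apply: ler_sum => i _.
  rewrite l1normZ normcX; apply: ler_pM; rewrite ?exprn_ge0 ?normc_ge0 ?l1norm_ge0 //.
    rewrite lerXn2r ?nnegrE ?normc_ge0 //; first by lra.
    by apply: le_trans (normc_disc dz) _; lra.
  by apply: MW; rewrite -ltnS.
apply: (@le_trans _ _ (c2 * normc z)); last first.
  by rewrite ler_wpM2r // le_max lexx orbT.
rewrite -sumrB mulr_suml; apply: le_trans (l1norm_sum _ _) _; apply: ler_sum => i _.
rewrite -scalerBl l1normZ mulrAC; apply: ler_pM; rewrite ?normc_ge0 ?l1norm_ge0 //.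
  exact: normc_exp_sub.
by apply: MW; rewrite -ltnS.
Qed.

(** A root y outside of the closed disc stays at distance at least |y - x| - r from
    it; the factorization of h turns these distances into a lower bound. *)
Lemma poly_lower_bound (h : {poly F}) :
  (forall z, disc z -> ~~ root h (x + z)) -> 0 <= r ->
  exists c, 0 < c /\ forall z, disc z -> c <= normc h.[x + z].
Proof.
have [s ->] := closed_field_poly_normal h; move=> nr r0.
have lc0 : lead_coef h != 0.
  have := nr 0; rewrite /disc normc0 => /(_ r0).
  by apply: contra => /eqP ->; rewrite scale0r root0.
have : forall z, disc z -> {in s, forall y, x + z != y}.
  move=> z dz y ys; apply: contra (nr z dz) => /eqP ->.
  by rewrite rootZ // root_prod_XsubC.
move=> {}nr; suff [c [c0 cP]] : exists c, 0 < c /\ forall z, disc z ->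
    c <= normc (\prod_(y <- s) ('X - y%:P)).[x + z].
  exists (normc (lead_coef h) * c); rewrite mulr_gt0 ?normc_gt0 //; split=> // z dz.
  by rewrite hornerZ normcM ler_wpM2l ?normc_ge0 ?cP.
elim: s nr => [|y s IH] nr.
  exists 1; split=> // z _.
  by rewrite big_nil hornerC ComplexField.Normc.normc1.
have [|c [c0 cP]] := IH; first by move=> z dz u us; apply: nr; rewrite // inE us orbT.
have far : r < normc (y - x).
  rewrite ltNge; apply/negP => dy.
  by have := nr _ dy y (mem_head _ _); rewrite subrKC eqxx.
exists ((normc (y - x) - r) * c); rewrite mulr_gt0 ?subr_gt0 //; split=> // z dz.
rewrite big_cons hornerM normcM ler_pM ?subr_ge0 ?(ltW far) ?(ltW c0) ?cP //.
rewrite hornerXsubC; have := normcB_ge (y - x) (x + z - y).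
have -> : y - x + (x + z - y) = z by ring.
by move: dz; rewrite /disc ler_norml => ? /andP[_ ?]; lra.
Qed.

End Modulus.

(** * First-order displacement of an eigenvalue *)

Section Perturbation.
Variable R : realType.
Local Notation F := R[i].
Local Notation normc := (@ComplexField.Normc.normc R).

(** The logarithmic derivative of the product is the sum of the 1 / (x - y), each
    of modulus at most 1 / t. The statement is free of divisions to cover a
    vanishing product. *)
Lemma deriv_prod_far_roots (s : seq F) x t :
  {in s, forall y, t <= normc (y - x)} ->
  t * normc (\prod_(y <- s) ('X - y%:P))^`().[x] <=
    (size s)%:R * normc (\prod_(y <- s) ('X - y%:P)).[x].
Proof.
have [t0 _|t0] := leP t 0.
  apply: (@le_trans _ _ 0); last by rewrite mulr_ge0 ?normc_ge0.
  by rewrite mulr_le0_ge0 ?normc_ge0.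
elim: s => [|y s IH] far.
  by rewrite big_nil derivC horner0 normc0 mulr0 mul0r.
have {}IH := IH (fun z zs => far z (mem_behead (s := y :: s) zs)).
have ty := far y (mem_head _ _).
rewrite !big_cons; set q := \prod_(z <- s) _ in IH *.
rewrite derivM derivXsubC mul1r hornerD !hornerM hornerXsubC /= -natr1 normcM.
apply: (@le_trans _ _ (t * (normc q.[x] + normc (x - y) * normc q^`().[x]))).
  by rewrite ler_wpM2l ?(ltW t0) // -normcM normcD.
have -> : normc (x - y) = normc (y - x) by rewrite -normcNE opprB.
have q0 := normc_ge0 q.[x]; have yx := normc_ge0 (y - x).
have h1 : t * normc q.[x] <= normc (y - x) * normc q.[x] by rewrite ler_wpM2r.
have h2 : normc (y - x) * (t * normc q^`().[x]) <=
  normc (y - x) * ((size s)%:R * normc q.[x]) by rewrite ler_wpM2l.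
lra.
Qed.

(** If all roots were farther from x, the logarithmic derivative of q at x would
    be too small. This locates a root from the value and the slope of q at x
    alone. *)
Lemma root_near (q : {poly F}) x : q^`().[x] != 0 ->
  exists z, root q z /\ normc (z - x) * normc q^`().[x] <= (size q)%:R * normc q.[x].
Proof.
move=> q'x; apply: contrapT => nz.
have nq'x : 0 < normc q^`().[x] by rewrite normc_gt0.
pose t := (size q)%:R * normc q.[x] / normc q^`().[x].
have far z : root q z -> t < normc (z - x).
  by move=> qz; rewrite ltr_pdivrMr // ltNge; apply/negP => ?; apply: nz; exists z.
have q0 : q != 0 by apply: contraNneq q'x => ->; rewrite deriv0 horner0.
have lc : lead_coef q != 0 by rewrite lead_coef_eq0.
have [s qE] := closed_field_poly_normal q.
have sz : size q = (size s).+1 by rewrite qE size_scale // size_prod_XsubC.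
have := @deriv_prod_far_roots s x t.
have fars : {in s, forall y, t <= normc (y - x)}.
  by move=> y ys; rewrite ltW // far // qE rootZ // root_prod_XsubC.
move=> /(_ fars) /(ler_wpM2l (normc_ge0 (lead_coef q))).
rewrite mulrCA [leRHS]mulrCA -!normcM -!hornerZ -derivZ -qE.
rewrite divfK ?gt_eqF // sz -natr1 mulrDl mul1r gerDl => qx.
have /far : root q x.
  rewrite /root; apply: contraTT qx; rewrite -normc_gt0; by rewrite -ltNge.
by rewrite subrr normc0 ltNge divr_ge0 ?mulr_ge0 ?normc_ge0.
Qed.

Lemma small_mul_le_half (t e : R) :
  0 <= t -> e <= (2 * (t + 1))^-1 -> t * e <= 1 / 2.
Proof.
by move=> t0; rewrite -[X in _ <= X]mul1r ler_pdivlMr; [nra|lra].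
Qed.

Lemma le_double (a b u : R) : u <= a + b -> b <= 1 / 2 * u -> u <= 2 * a.
Proof. lra. Qed.

Section FirstOrder.
Variables (m : nat) (P : 'M[{poly F}]_m) (x : F) (v w : 'cV[F]_m) (r lo : R).
Variables (L : 'M[F]_m) (phi : 'cV[F]_m -> F).
Hypotheses (wP : w^T *m mxeval P x = 0)
  (split_v : forall u, u = phi u *: v + L *m (mxeval P x *m u))
  (lo0 : 0 < lo)
  (detP : forall z, normc z <= r -> lo * normc z <= normc (\det P).[x + z]).

Let form (M : 'M[F]_m) (u : 'cV[F]_m) : F := (w^T *m M *m u) 0 0.

Let formDl M N u : form (M + N) u = form M u + form N u.
Proof. by rewrite /form mulmxDr mulmxDl mxE. Qed.

Let formZl a M u : form (a *: M) u = a * form M u.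
Proof. by rewrite /form -scalemxAr -scalemxAl mxE. Qed.

Let formD M u u' : form M (u + u') = form M u + form M u'.
Proof. by rewrite /form mulmxDr mxE. Qed.

Let formZ a M u : form M (a *: u) = a * form M u.
Proof. by rewrite /form -scalemxAr mxE. Qed.

Let form_le M u : normc (form M u) <= l1norm w^T * l1norm M * l1norm u.
Proof.
apply: le_trans (l1norm_entry _ 0 0) _; apply: le_trans (l1normM _ _) _.
by rewrite ler_wpM2r ?l1norm_ge0 ?l1normM.
Qed.

Hypothesis slope : form (mxeval (mxderiv P) x) v != 0.

(** For an eigenvector u of P + e E at x + dx, multiplying by adj(P) gives
    |det P(x + dx)| = O(e), hence dx = O(e); then P(x) u = O(e), so u is a nonzero
    multiple of v up to O(e); finally w^T kills P(x) and leaves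
    dx w^T P'(x) v + e w^T E(x) v = O(e^2). Each constant depends on k and W but
    not on E. *)
Lemma first_order k W : exists c e0, [/\ 0 <= c, 0 < e0 &
  forall (E : 'M[{poly F}]_m), mxdeg_le k E ->
    (forall i, (i <= k)%N -> l1norm (mxcoef E i) <= W) ->
  forall (e : R) dx, 0 < e <= e0 -> normc dx <= r ->
    pmx_eigenvalue (P + (e%:C)%:P *: E) (x + dx) ->
    `| normc dx / e - normc ((w^T *m mxeval E x *m v) 0 0) /
         normc ((w^T *m mxeval (mxderiv P) x *m v) 0 0)| <= c * e].
Proof.
have [Ka [Ka0 adjB]] := mxeval_bound x r (\adj P).
have [Kt [Kt0 taylB]] := mxeval_taylor_bound x r P.
have [K0 KB] := @mxeval_uniform_bound _ x r k W m m.
pose K := Num.max 0 K0; pose p1 := l1norm (mxeval (mxderiv P) x).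
have K_0 : 0 <= K by rewrite /K le_max lexx.
have p10 : 0 <= p1 := l1norm_ge0 _.
pose lv := l1norm v; pose lw := l1norm w^T; pose lL := l1norm L.
have [lv0 lw0 lL0] : [/\ 0 <= lv, 0 <= lw & 0 <= lL] by split; exact: l1norm_ge0.
pose r' := Num.max 0 r; have r'0 : 0 <= r' by rewrite /r' le_max lexx.
pose c1 := Ka * K / lo; have c10 : 0 <= c1 by rewrite divr_ge0 ?mulr_ge0 ?(ltW lo0).
pose c2 := K + c1 * p1 + Kt * c1 * r'.
have c20 : 0 <= c2 := addr_ge0 (addr_ge0 K_0 (mulr_ge0 c10 p10)) (mulr_ge0 (mulr_ge0 Kt0 c10) r'0).
pose c3 := lL * c2; have c30 : 0 <= c3 := mulr_ge0 lL0 c20.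
pose c4 := lw * (Kt * c1 ^+ 2 + K * c1 + c1 * p1 * c3 + K * c3).
have c40 : 0 <= c4.
  by rewrite /c4 mulr_ge0 // !addr_ge0 // mulr_ge0 ?exprn_ge0 // mulr_ge0.
set kap := normc _; have kap0 : 0 < kap by rewrite normc_gt0.
(* |dx| <= c1 e, |P(x) u| <= c2 e |u|, the part of u off the line of v is at most
   c3 e |u|, and the first-order equation holds up to c4 e^2 |u|; the bound on e
   makes c3 e <= 1/2 *)
exists (2 * lv * c4 / kap), (2 * (c3 + 1))^-1; split.
- by rewrite divr_ge0 ?(ltW kap0) // mulr_ge0 // mulr_ge0.
- by rewrite invr_gt0; lra.
move=> E dE EW e dx /andP[e0 ee] dxr [u [u0]].
have [EB ED] : l1norm (mxeval E (x + dx)) <= K /\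
    l1norm (mxeval E (x + dx) - mxeval E x) <= K * normc dx.
  have [h1 h2] := KB E dE EW dx dxr; split.
    by rewrite /K le_max h1 orbT.
  by apply: le_trans h2 _; rewrite ler_wpM2r ?normc_ge0 // le_max lexx orbT.
have {KB}EBx : l1norm (mxeval E x) <= K.
  have r0 : 0 <= r := le_trans (normc_ge0 dx) dxr.
  have := (KB E dE EW 0); rewrite normc0 addr0 => /(_ r0)[h _].
  by rewrite /K le_max h orbT.
rewrite mxevalD mxevalZ hornerC mulmxDl -scalemxAl => Pu.
have {}Pu : mxeval P (x + dx) *m u = - (e%:C *: (mxeval E (x + dx) *m u)).
  by apply/eqP; rewrite -addr_eq0 Pu.
pose U := l1norm u; have U0 : 0 < U := l1norm_gt0 u0.
have ne : normc e%:C = e by rewrite normc_real gtr0_norm.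
have d0 := normc_ge0 dx.
have Eu : l1norm (mxeval E (x + dx) *m u) <= K * U.
  by apply: le_trans (l1normM _ _) _; rewrite ler_wpM2r ?(ltW U0).
(* adj(P) P u = (det P) u, and det P is at least lo |dx| *)
have dx1 : normc dx <= c1 * e.
  have : mxeval (\adj P) (x + dx) *m (mxeval P (x + dx) *m u) =
     (\det P).[x + dx] *: u.
    by rewrite mulmxA -mxevalM mul_adj_mx mxeval_scalar mul_scalar_mx.
  rewrite Pu mulmxN -scalemxAr => /(congr1 (@l1norm _ _ _)).
  rewrite l1normN !l1normZ ne => detE.
  have h : normc (\det P).[x + dx] * U <= e * (Ka * (K * U)).
    rewrite -detE ler_wpM2l ?(ltW e0) //; apply: le_trans (l1normM _ _) _.
    by apply: ler_pM; rewrite ?l1norm_ge0 ?adjB.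
  have : lo * normc dx * U <= e * (Ka * K) * U.
    rewrite -[leRHS]mulrA -[Ka * K * U]mulrA; apply: le_trans h.
    by rewrite ler_wpM2r ?(ltW U0) ?detP.
  by rewrite ler_pM2r // /c1 mulrAC ler_pdivlMr // [lo * _]mulrC [e * _]mulrC.
pose T := mxeval P (x + dx) - mxeval P x - dx *: mxeval (mxderiv P) x.
have TB : l1norm T <= Kt * normc dx ^+ 2 by exact: taylB.
have PT : mxeval P (x + dx) = mxeval P x + dx *: mxeval (mxderiv P) x + T.
  by rewrite [RHS]addrC /T -[X in _ = X + _]addrA -opprD subrK.
have Tu : l1norm (T *m u) <= Kt * normc dx ^+ 2 * U.
  by apply: le_trans (l1normM _ _) _; rewrite ler_wpM2r ?(ltW U0).
have dxr' : normc dx <= r' by rewrite /r' le_max dxr orbT.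
have Pxu : l1norm (mxeval P x *m u) <= c2 * e * U.
  have -> : mxeval P x *m u = - (e%:C *: (mxeval E (x + dx) *m u)) -
      dx *: (mxeval (mxderiv P) x *m u) - T *m u.
    by rewrite -Pu PT !mulmxDl -scalemxAl -[RHS]addrA -opprD -[X in X - _]addrA addrK.
  have h1 : l1norm (- (dx *: (mxeval (mxderiv P) x *m u))) <= c1 * e * (p1 * U).
    by rewrite l1normN l1normZ; apply: ler_pM; rewrite ?l1norm_ge0 ?l1normM.
  have h2 : normc dx ^+ 2 <= c1 * e * r' by rewrite expr2; apply: ler_pM.
  have h3 : l1norm (- (T *m u)) <= Kt * (c1 * e * r') * U.
    by rewrite l1normN (le_trans Tu) // ler_wpM2r ?(ltW U0) // ler_wpM2l.
  have h4 : l1norm (- (e%:C *: (mxeval E (x + dx) *m u))) <= e * (K * U).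
    by rewrite l1normN l1normZ ne ler_wpM2l ?(ltW e0).
  have -> : c2 * e * U = e * (K * U) + c1 * e * (p1 * U) + Kt * (c1 * e * r') * U.
    by rewrite /c2; ring.
  apply: le_trans (l1normD _ _) (lerD _ h3).
  exact: le_trans (l1normD _ _) (lerD h4 h1).
pose rho := L *m (mxeval P x *m u).
have rhoB : l1norm rho <= c3 * e * U.
  apply: le_trans (l1normM _ _) _.
  have -> : c3 * e * U = lL * (c2 * e * U) by rewrite /c3; ring.
  by rewrite ler_wpM2l.
pose al := phi u; have uE : u = al *: v + rho by exact: split_v.
have c3e : c3 * e <= 1 / 2 := small_mul_le_half c30 ee.
(* at least half of u lies along v *)
have Ual : U <= 2 * normc al * lv.
  rewrite -mulrA; apply: (@le_double _ (l1norm rho)).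
    by rewrite /U {1}uE; apply: le_trans (l1normD _ _) _; rewrite l1normZ.
  by apply: le_trans rhoB _; rewrite ler_wpM2r ?(ltW U0).
have al0 : 0 < normc al.
  rewrite lt_neqAle normc_ge0 andbT; apply: contraTneq U0 => al0.
  by rewrite -leNgt (le_trans Ual) // -al0 mulr0 mul0r.
set kap' := (w^T *m _ *m v) 0 0 in kap kap0 *; set del := (w^T *m _ *m v) 0 0.
(* the equation of u multiplied by w^T, with u = al v + rho *)
have main : normc (al * (dx * kap' + e%:C * del)) <= c4 * e ^+ 2 * U.
  have -> : al * (dx * kap' + e%:C * del) =
    - (form T u + e%:C * form (mxeval E (x + dx) - mxeval E x) u +
       dx * form (mxeval (mxderiv P) x) rho + e%:C * form (mxeval E x) rho).
    have Px0 : form (mxeval P x) u = 0 by rewrite /form wP mul0mx mxE.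
    have Py : form (mxeval P (x + dx)) u = - (e%:C * form (mxeval E (x + dx)) u).
      have -> M y : form M y = (w^T *m (M *m y)) 0 0 by rewrite /form mulmxA.
      by rewrite Pu mulmxN -scalemxAr mxE mxE /form -mulmxA.
    have EyE : mxeval E (x + dx) = mxeval E (x + dx) - mxeval E x + mxeval E x.
      by rewrite subrK.
    have sp M : form M u = al * form M v + form M rho by rewrite {1}uE formD formZ.
    move: Py; rewrite PT {1}EyE 2!formDl [form (_ + mxeval E x) u]formDl formZl Px0.
    rewrite (sp (mxeval (mxderiv P) x)) (sp (mxeval E x)).
    rewrite -[form _ v]/kap' -[form (mxeval E x) v]/del add0r => /eqP.
    rewrite -subr_eq0 => /eqP eq0; apply/eqP; rewrite -subr_eq0 -eq0; apply/eqP.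
    by ring.
  rewrite normcNE.
  have h1 : normc (form T u) <= lw * (Kt * (c1 * e) ^+ 2) * U.
    apply: le_trans (form_le _ _) _; rewrite ler_wpM2r ?(ltW U0) // ler_wpM2l //.
    apply: le_trans TB _; rewrite ler_wpM2l // lerXn2r ?nnegrE //.
    by apply: le_trans dx1.
  have h2 : normc (e%:C * form (mxeval E (x + dx) - mxeval E x) u) <=
      e * (lw * (K * (c1 * e)) * U).
    rewrite normcM ne ler_wpM2l ?(ltW e0) //; apply: le_trans (form_le _ _) _.
    rewrite ler_wpM2r ?(ltW U0) // ler_wpM2l //; apply: le_trans ED _.
    by rewrite ler_wpM2l.
  have h3 : normc (dx * form (mxeval (mxderiv P) x) rho) <=
      c1 * e * (lw * p1 * (c3 * e * U)).
    rewrite normcM; apply: ler_pM; rewrite ?normc_ge0 //.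
    by apply: le_trans (form_le _ _) _; rewrite ler_wpM2l // mulr_ge0.
  have h4 : normc (e%:C * form (mxeval E x) rho) <= e * (lw * K * (c3 * e * U)).
    rewrite normcM ne ler_wpM2l ?(ltW e0) //; apply: le_trans (form_le _ _) _.
    by apply: ler_pM; rewrite ?mulr_ge0 ?l1norm_ge0 // ler_wpM2l.
  apply: le_trans (normcD _ _) _; apply: le_trans (lerD (normcD _ _) h4) _.
  apply: le_trans (lerD (lerD (normcD _ _) h3) (lexx _)) _.
  apply: le_trans (lerD (lerD (lerD h1 h2) (lexx _)) (lexx _)) _.
  by rewrite le_eqVlt; apply/orP; left; apply/eqP; rewrite /c4; ring.
have key : normc (dx * kap' + e%:C * del) <= 2 * lv * c4 * e ^+ 2.
  rewrite -(ler_pM2l al0) -normcM; apply: le_trans main _.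
  have -> : normc al * (2 * lv * c4 * e ^+ 2) = c4 * e ^+ 2 * (2 * normc al * lv) by ring.
  by rewrite ler_wpM2l // mulr_ge0 // exprn_ge0 // ltW.
have -> : normc dx / e - normc del / kap = (normc dx * kap - e * normc del) / (e * kap).
  by field; rewrite !gt_eqF.
have ek : 0 < e * kap by rewrite mulr_gt0.
rewrite normrM normfV (gtr0_norm ek) ler_pdivrMr //.
have -> : 2 * lv * c4 / kap * e * (e * kap) = 2 * lv * c4 * e ^+ 2.
  by field; rewrite gt_eqF.
by apply: le_trans key; rewrite -{1}ne -!normcM normcB_ge.
Qed.

End FirstOrder.

End Perturbation.

(** * Persistence of a simple eigenvalue *)

Section RootPersistence.
Variable R : realType.
Local Notation F := R[i].
Local Notation normc := (@ComplexField.Normc.normc R).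

(** This applies to the cofactor of e in det (P + e E) - det P, whose value and
    slope at x have to stay bounded as e tends to 0. *)
Lemma poly_family_bound (Q : {poly {poly F}}) x : exists c s, 0 <= c /\
  forall t : F, normc t <= 1 -> [/\ normc Q.[t%:P].[x] <= c,
    normc (Q.[t%:P])^`().[x] <= c & (size Q.[t%:P] <= s)%N].
Proof.
elim/poly_ind: Q => [|Q a [c [s [c0 Qc]]]].
  exists 0, 0; split=> // t _.
  by rewrite !horner0 deriv0 horner0 normc0 size_poly0.
exists (c + normc a.[x] + normc a^`().[x]), (maxn s (size a)); split.
  by rewrite !addr_ge0 ?normc_ge0.
move=> t t1; have [h1 h2 h3] := Qc t t1; rewrite hornerMXaddC mulrC mul_polyC.
have tle y : normc y <= c -> normc (t * y) <= c.
  move=> yc; rewrite normcM; apply: le_trans yc.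
  by rewrite ler_piMl ?normc_ge0.
have [a0 a1] := (normc_ge0 a.[x], normc_ge0 a^`().[x]); split.
- rewrite hornerD hornerZ; apply: le_trans (normcD _ _) _.
  by rewrite -addrA lerD ?tle // lerDl.
- rewrite derivD derivZ hornerD hornerZ; apply: le_trans (normcD _ _) _.
  by rewrite lerD // (le_trans (tle _ h2)) // lerDl.
apply: leq_trans (size_polyD _ _) _; rewrite geq_max !leq_max leqnn orbT andbT.
by rewrite (leq_trans (size_scale_leq _ _)).
Qed.

(** The determinant is a polynomial in t with constant term det P. *)
Lemma det_pencil m (P E : 'M[{poly F}]_m) : exists Q : {poly {poly F}},
  forall t : F, \det (P + t%:P *: E) = \det P + t%:P * Q.[t%:P].
Proof.
pose D := \det (map_mx polyC P + 'X *: map_mx polyC E).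
have DE y : D.[y] = \det (P + y *: E).
  rewrite -[LHS]/(horner_eval y D) -det_map_mx; congr (\det _).
  by apply/matrixP => i j; rewrite !mxE /= /horner_eval !hornerE.
have [Q QE] : exists Q, D - (D.[0])%:P = Q * ('X - 0%:P).
  by apply/factor_theorem; rewrite /root !hornerE subrr.
exists Q => t; move/(congr1 (fun f => f.[t%:P])): QE.
rewrite hornerD hornerN hornerC hornerM hornerXsubC subr0 !DE scale0r addr0 mulrC.
by move=> <-; rewrite [RHS]addrC subrK.
Qed.

(** The determinant of P + e E is O(e) at x, while its derivative there stays
    close to h(x) <> 0 and its degree is bounded: root_near yields a root at
    distance O(e) of x. Here the bound e1 depends on E. *)
Lemma simple_root_persists m (P E : 'M[{poly F}]_m) x r h :
  \det P = ('X - x%:P) * h -> h.[x] != 0 -> 0 < r ->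
  exists e1 : R, 0 < e1 /\ forall e : R, 0 < e <= e1 ->
    exists dx, normc dx <= r /\ pmx_eigenvalue (P + (e%:C)%:P *: E) (x + dx).
Proof.
move=> detP hx r0; have [Q QE] := det_pencil P E.
have [c [s [c0 Qc]]] := poly_family_bound Q x.
pose H := normc h.[x]; have H0 : 0 < H by rewrite normc_gt0.
pose S := maxn (size (\det P)) s.
have sc0 : 0 <= S%:R * c by rewrite mulr_ge0.
have d1 : 0 < 2 * (c + 1) by lra.
have d2 : 0 < 2 * (S%:R * c + 1) by lra.
exists (Num.min 1 (Num.min (H / (2 * (c + 1))) (r * H / (2 * (S%:R * c + 1))))).
split; first by rewrite !lt_min ltr01 !divr_gt0 // mulr_gt0.
move=> e /andP[e0]; rewrite !le_min => /and3P[e1].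
rewrite !ler_pdivlMr // => eH er.
have ne : normc e%:C = e by rewrite normc_real gtr0_norm.
have [] := Qc e%:C; first by rewrite ne.
have := QE e%:C; set q := \det _; set b := Q.[_] => qE b1 b2 bs.
have qx : normc q.[x] <= e * c.
  rewrite qE detP hornerD !hornerM hornerXsubC subrr mul0r add0r hornerC normcM ne.
  by rewrite ler_wpM2l // ltW.
have q'x : H / 2 <= normc q^`().[x].
  rewrite qE detP derivD !derivM derivXsubC derivC mul1r mul0r add0r.
  rewrite !hornerD !hornerM hornerXsubC subrr mul0r addr0 hornerC.
  have := normcB_ge h.[x] (e%:C * b^`().[x]); rewrite normcM ne -/H ler_norml.
  have : e * normc b^`().[x] <= e * c by rewrite ler_wpM2l // ltW.
  by move=> h1 /andP[_ h2]; lra.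
have sq : (size q <= S)%N.
  rewrite qE; apply: leq_trans (size_polyD _ _) _; rewrite geq_max leq_maxl /=.
  by rewrite mul_polyC (leq_trans (size_scale_leq _ _)) // leq_max bs orbT.
have [|z [qz zx]] := @root_near _ q x.
  by rewrite -normc_gt0 (lt_le_trans _ q'x) // divr_gt0.
exists (z - x); rewrite subrKC; split; last by apply/eigenvalue_det/eqP.
have h1 : normc (z - x) * (H / 2) <= S%:R * (e * c).
  apply: le_trans (ler_wpM2l (normc_ge0 _) q'x) _; apply: le_trans zx _.
  by apply: ler_pM; rewrite ?normc_ge0 // ler_nat.
rewrite -(ler_pM2r H0); lra.
Qed.

End RootPersistence.

(** * The spectral norm and the block weights *)

Section SpectralNorm.
Variable R : realType.
Local Notation F := R[i].
Local Notation normc := (@ComplexField.Normc.normc R).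

Lemma vnorm2_ge0 m (u : 'cV[F]_m) : 0 <= vnorm2 u.
Proof. exact: sqrtr_ge0. Qed.

Lemma vnorm2_sqr m (u : 'cV[F]_m) : vnorm2 u ^+ 2 = \sum_i normc (u i 0) ^+ 2.
Proof. by rewrite sqr_sqrtr // sumr_ge0 // => i _; rewrite sqr_ge0. Qed.

Lemma vnorm2_entry m (u : 'cV[F]_m) i : normc (u i 0) <= vnorm2 u.
Proof.
rewrite -(@ler_pXn2r _ 2) ?nnegrE ?normc_ge0 ?vnorm2_ge0 // vnorm2_sqr (bigD1 i) //=.
by rewrite lerDl sumr_ge0 // => j _; rewrite sqr_ge0.
Qed.

Lemma vnorm2_le_l1norm m (u : 'cV[F]_m) : vnorm2 u <= l1norm u.
Proof.
rewrite -(@ler_pXn2r _ 2) ?nnegrE ?l1norm_ge0 ?vnorm2_ge0 // vnorm2_sqr expr2.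
rewrite {2}/l1norm mulr_sumr; apply: ler_sum => i _; rewrite big_ord1 expr2.
by rewrite ler_wpM2r ?normc_ge0 ?l1norm_entry.
Qed.

Lemma vnorm2Z m z (u : 'cV[F]_m) : vnorm2 (z *: u) = normc z * vnorm2 u.
Proof.
rewrite -[normc z]ger0_norm ?normc_ge0 // -sqrtr_sqr -sqrtrM ?sqr_ge0 //.
congr Num.sqrt; rewrite mulr_sumr; apply: eq_bigr => i _.
by rewrite mxE normcM exprMn.
Qed.

Lemma vnorm20 m : vnorm2 (0 : 'cV[F]_m) = 0.
Proof. by rewrite -(scale0r (0 : 'cV[F]_m)) vnorm2Z normc0 mul0r. Qed.

Lemma vnorm2_eq0 m (u : 'cV[F]_m) : vnorm2 u = 0 -> u = 0.
Proof.
move=> u0; apply/matrixP => i j; rewrite (ord1 j) mxE.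
have := vnorm2_entry u i; rewrite u0 => h.
by apply/ComplexField.Normc.eq0_normc/le_anti; rewrite h normc_ge0.
Qed.

Lemma vnorm2_col_mx m q (u1 : 'cV[F]_m) (u2 : 'cV[F]_q) :
  vnorm2 (col_mx u1 u2) = Num.sqrt (vnorm2 u1 ^+ 2 + vnorm2 u2 ^+ 2).
Proof.
rewrite !vnorm2_sqr; congr Num.sqrt; rewrite big_split_ord.
by congr (_ + _); apply: eq_bigr => i _; rewrite ?col_mxEu ?col_mxEd.
Qed.

Lemma cauchy_schwarz m (w u : 'cV[F]_m) :
  normc ((w^T *m u) 0 0) <= vnorm2 w * vnorm2 u.
Proof.
have [w0|w0] := eqVneq (vnorm2 w) 0.
  by rewrite (vnorm2_eq0 w0) trmx0 mul0mx mxE normc0 mulr_ge0 ?vnorm2_ge0.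
have [u0|u0] := eqVneq (vnorm2 u) 0.
  by rewrite (vnorm2_eq0 u0) mulmx0 mxE normc0 mulr_ge0 ?vnorm2_ge0.
have wp : 0 < vnorm2 w by rewrite lt_neqAle eq_sym w0 vnorm2_ge0.
have up : 0 < vnorm2 u by rewrite lt_neqAle eq_sym u0 vnorm2_ge0.
rewrite -ler_pdivrMr //; rewrite mxE.
(* the weighted inequality 2 s t <= s^2 + t^2, summed over the entries *)
have ineq (s t : R) : s * t <= (vnorm2 w * vnorm2 u) / 2 *
    (s ^+ 2 / vnorm2 w ^+ 2 + t ^+ 2 / vnorm2 u ^+ 2).
  rewrite -subr_ge0.
  have -> : vnorm2 w * vnorm2 u / 2 * (s ^+ 2 / vnorm2 w ^+ 2 + t ^+ 2 / vnorm2 u ^+ 2)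
     - s * t = (s * vnorm2 u - t * vnorm2 w) ^+ 2 / (2 * vnorm2 w * vnorm2 u).
    by field; rewrite w0 u0.
  by rewrite divr_ge0 ?sqr_ge0 // !mulr_ge0 // ltW.
rewrite ler_pdivrMr //; apply: le_trans (normc_sum _ _ _) _.
apply: (@le_trans _ _ (\sum_i (vnorm2 w * vnorm2 u) / 2 *
    (normc (w i 0) ^+ 2 / vnorm2 w ^+ 2 + normc (u i 0) ^+ 2 / vnorm2 u ^+ 2))).
  by apply: ler_sum => i _; rewrite mxE normcM.
rewrite -mulr_sumr big_split /= -!mulr_suml -!vnorm2_sqr.
by rewrite le_eqVlt; apply/orP; left; apply/eqP; field; rewrite w0 u0.
Qed.

Lemma mxnorm2_ub m q (M : 'M[F]_(m, q)) : has_ubound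
  [set vnorm2 (M *m u) | u in [set u : 'cV[F]_q | vnorm2 u <= 1]].
Proof.
exists (l1norm M * q%:R) => _ [u u1 <-].
apply: le_trans (vnorm2_le_l1norm _) _; apply: le_trans (l1normM _ _) _.
rewrite ler_wpM2l ?l1norm_ge0 //; apply: (@le_trans _ _ (\sum_(i < q) 1)).
  apply: ler_sum => i _; rewrite big_ord1.
  exact: le_trans (vnorm2_entry _ _) u1.
by rewrite sumr_const card_ord.
Qed.

Lemma vnorm2M m q (M : 'M[F]_(m, q)) u : vnorm2 (M *m u) <= mxnorm2 M * vnorm2 u.
Proof.
have [u0|u0] := eqVneq (vnorm2 u) 0.
  by rewrite u0 mulr0 (vnorm2_eq0 u0) mulmx0 vnorm20.
have up : 0 < vnorm2 u by rewrite lt_neqAle eq_sym u0 vnorm2_ge0.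
rewrite -ler_pdivrMr //; apply: ub_le_sup; first exact: mxnorm2_ub.
have nv : normc ((vnorm2 u)^-1)%:C = (vnorm2 u)^-1.
  by rewrite normc_real ger0_norm // invr_ge0 ltW.
exists (((vnorm2 u)^-1)%:C *: u) => /=; first by rewrite vnorm2Z nv mulVf.
by rewrite -scalemxAr vnorm2Z nv mulrC.
Qed.

Lemma mxnorm2_ge0 m q (M : 'M[F]_(m, q)) : 0 <= mxnorm2 M.
Proof.
apply: le_trans (vnorm2_ge0 (M *m 0)) _; apply: ub_le_sup; first exact: mxnorm2_ub.
by exists 0 => //=; rewrite vnorm20 ler01.
Qed.

Lemma mxnorm20 m q : mxnorm2 (0 : 'M[F]_(m, q)) = 0.
Proof.
apply/le_anti; rewrite mxnorm2_ge0 andbT; apply: ge_sup.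
  by exists (vnorm2 ((0 : 'M[F]_(m, q)) *m 0)); exists 0 => //=; rewrite vnorm20 ler01.
by move=> _ [u _ <-]; rewrite mul0mx vnorm20.
Qed.

Lemma bilinear_mxnorm2 m q (M : 'M[F]_(m, q)) (w : 'cV[F]_m) u :
  normc ((w^T *m M *m u) 0 0) <= vnorm2 w * mxnorm2 M * vnorm2 u.
Proof.
rewrite -mulmxA; apply: le_trans (cauchy_schwarz _ _) _; rewrite -mulrA.
by rewrite ler_wpM2l ?vnorm2_ge0 ?vnorm2M.
Qed.

End SpectralNorm.

Section BlockWeights.
Variable R : realType.
Local Notation F := R[i].
Local Notation normc := (@ComplexField.Normc.normc R).

Definition gain (a b c d s t : R) := (a * s + b * t) ^+ 2 + (c * s + d * t) ^+ 2.

(** Both sides are homogeneous in (s, t), which may be scaled to the unit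
    circle; there the left-hand side is one of the values under the supremum. *)
Lemma gain_le (a b c d s t : R) :
  Num.sqrt (gain a b c d s t) <= Num.sqrt (s ^+ 2 + t ^+ 2) *
    Num.sqrt (sup [set gain a b c d y.1 y.2 | y in
      [set y : R * R | y.1 ^+ 2 + y.2 ^+ 2 = 1]]).
Proof.
have st0 : 0 <= s ^+ 2 + t ^+ 2 by rewrite addr_ge0 ?sqr_ge0.
rewrite -sqrtrM //; apply: ler_wsqrtr.
have [st|st] := eqVneq (s ^+ 2 + t ^+ 2) 0.
  have s0 : s = 0 by apply/eqP; rewrite -sqrf_eq0; apply/eqP; have := sqr_ge0 s; have := sqr_ge0 t; lra.
  have t0 : t = 0 by apply/eqP; rewrite -sqrf_eq0; apply/eqP; have := sqr_ge0 s; have := sqr_ge0 t; lra.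
  by rewrite /gain s0 t0 !mulr0 addr0 expr0n /= addr0 mul0r.
have stp : 0 < s ^+ 2 + t ^+ 2 by rewrite lt_neqAle eq_sym st.
rewrite mulrC -ler_pdivrMr //; apply: ub_le_sup.
  exists (2 * (a ^+ 2 + b ^+ 2 + c ^+ 2 + d ^+ 2)) => _ [[y1 y2] /= y <-].
  rewrite /gain; have h (e f : R) : (e * y1 + f * y2) ^+ 2 <= 2 * (e ^+ 2 + f ^+ 2).
    have -> : (e * y1 + f * y2) ^+ 2 = (e ^+ 2 + f ^+ 2) * (y1 ^+ 2 + y2 ^+ 2) - (e * y2 - f * y1) ^+ 2 by ring.
    by rewrite y; have := sqr_ge0 (e * y2 - f * y1); have := sqr_ge0 e; have := sqr_ge0 f; lra.
  by have := h a b; have := h c d; lra.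
pose T := Num.sqrt (s ^+ 2 + t ^+ 2).
have TT : T ^+ 2 = s ^+ 2 + t ^+ 2 by rewrite sqr_sqrtr.
have T0 : T != 0 by rewrite sqrtr_eq0 -ltNge.
exists (s / T, t / T) => /=; first by rewrite !exprMn -mulrDl exprVn TT mulfV.
by rewrite -TT /gain; field.
Qed.

Lemma cauchy_schwarz2 (a b s t : R) :
  a * s + b * t <= Num.sqrt (a ^+ 2 + b ^+ 2) * Num.sqrt (s ^+ 2 + t ^+ 2).
Proof.
have h (e f : R) : 0 <= e ^+ 2 + f ^+ 2 by rewrite addr_ge0 ?sqr_ge0.
rewrite -sqrtrM //; apply: le_trans (ler_norm _) _; rewrite -sqrtr_sqr.
apply: ler_wsqrtr; rewrite -subr_ge0.
have -> : (a ^+ 2 + b ^+ 2) * (s ^+ 2 + t ^+ 2) - (a * s + b * t) ^+ 2 =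
  (a * t - b * s) ^+ 2 by ring.
exact: sqr_ge0.
Qed.

(** With w and v split into blocks, the left-hand side is at most
    |w1| (a |v1| + b |v2|) + |w2| (c |v1| + d |v2|), the inner product of
    (|w1|, |w2|) with the vector whose square length is the gain at (|v1|, |v2|). *)
Lemma block_bilinear_le n p (M11 : 'M[F]_n) (M12 : 'M[F]_(n, p)) (M21 : 'M[F]_(p, n))
    (M22 : 'M[F]_p) (v w : 'cV[F]_(n + p)) (a b c d : R) :
  mxnorm2 M11 <= a -> mxnorm2 M12 <= b -> mxnorm2 M21 <= c -> mxnorm2 M22 <= d ->
  normc ((w^T *m block_mx (- M11) M12 M21 M22 *m v) 0 0) <=
  vnorm2 w * vnorm2 v * Num.sqrt (sup [set gain a b c d y.1 y.2 | y in
      [set y : R * R | y.1 ^+ 2 + y.2 ^+ 2 = 1]]).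
Proof.
move=> h11 h12 h21 h22; rewrite -[w]vsubmxK -[v]vsubmxK.
move: (usubmx w) (dsubmx w) (usubmx v) (dsubmx v) => w1 w2 v1 v2.
rewrite tr_col_mx -mulmxA mul_block_col mul_row_col !mulmxDr mulNmx mulmxN !mulmxA.
rewrite !vnorm2_col_mx.
have le m q (M : 'M[F]_(m, q)) (y : 'cV[F]_m) z e : mxnorm2 M <= e ->
    normc ((y^T *m M *m z) 0 0) <= vnorm2 y * e * vnorm2 z.
  move=> Me; apply: le_trans (bilinear_mxnorm2 _ _ _) _.
  by rewrite ler_wpM2r ?vnorm2_ge0 // ler_wpM2l ?vnorm2_ge0.
apply: (@le_trans _ _ (vnorm2 w1 * (a * vnorm2 v1 + b * vnorm2 v2) +
    vnorm2 w2 * (c * vnorm2 v1 + d * vnorm2 v2))).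
  rewrite mxE; apply: le_trans (normcD _ _) _; apply: lerD.
    rewrite mxE; apply: le_trans (normcD _ _) _; rewrite mxE normcNE mulrDr !mulrA.
    by apply: lerD; apply: le.
  rewrite mxE; apply: le_trans (normcD _ _) _; rewrite mulrDr !mulrA.
  by apply: lerD; apply: le.
apply: le_trans (cauchy_schwarz2 _ _ _ _) _; rewrite -mulrA.
by rewrite ler_wpM2l ?sqrtr_ge0 // gain_le.
Qed.

End BlockWeights.

(** * Admissible perturbations *)

Section AdmissiblePerturbations.
Variable R : realType.
Local Notation F := R[i].
Local Notation normc := (@ComplexField.Normc.normc R).

Lemma admissible_trunc m q k wt (M : 'M[{poly F}]_(m, q)) i :
  admissible k wt M -> mxnorm2 (mxcoef M i) <= trunc_weight k wt i.
Proof.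
case=> dM Mwt; rewrite /trunc_weight; case: leqP => [/Mwt//|ki].
have -> : mxcoef M i = 0; last by rewrite mxnorm20.
by apply/matrixP => j l; rewrite !mxE nth_default // (leq_trans (dM j l)).
Qed.

Lemma admissible0 m q k wt : (forall i, (i <= k)%N -> 0 <= wt i) ->
  admissible k wt (0 : 'M[{poly F}]_(m, q)).
Proof.
move=> wt0; split=> [i j|i ik]; first by rewrite mxE size_poly0.
have -> : mxcoef (0 : 'M[{poly F}]_(m, q)) i = 0; last by rewrite mxnorm20 wt0.
by apply/matrixP => j l; rewrite !mxE coef0.
Qed.

Variables (n p kA kB kC kD : nat) (a b c d : nat -> R).
Local Notation deg := (maxn (maxn kA kB) (maxn kC kD)).

Definition admissible_system (E : 'M[{poly F}]_(n + p)) : Prop :=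
  exists (dA : 'M[{poly F}]_n) (dB : 'M[{poly F}]_(n, p))
    (dC : 'M[{poly F}]_(p, n)) (dD : 'M[{poly F}]_p),
  [/\ admissible kA a dA, admissible kB b dB, admissible kC c dC,
      admissible kD d dD & E = system_mx dA dB dC dD].

Lemma admissible_system_deg E : admissible_system E -> mxdeg_le deg E.
Proof.
case=> dA [dB [dC [dD [[hA _] [hB _] [hC _] [hD _] ->]]]] i j.
rewrite /system_mx; case: (splitP i) => i' ii'; case: (splitP j) => j' jj'.
- have -> : i = lshift p i' by apply: val_inj.
  have -> : j = lshift p j' by apply: val_inj.
  rewrite block_mxEul mxE size_polyN; apply: leq_trans (hA _ _) _.
  by rewrite ltnS !leq_max leqnn.
- have -> : i = lshift p i' by apply: val_inj.
  have -> : j = rshift n j' by apply: val_inj.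
  rewrite block_mxEur; apply: leq_trans (hB _ _) _.
  by rewrite ltnS !leq_max leqnn orbT.
- have -> : i = rshift n i' by apply: val_inj.
  have -> : j = lshift p j' by apply: val_inj.
  rewrite block_mxEdl; apply: leq_trans (hC _ _) _.
  by rewrite ltnS !leq_max leqnn !orbT.
have -> : i = rshift n i' by apply: val_inj.
have -> : j = rshift n j' by apply: val_inj.
rewrite block_mxEdr; apply: leq_trans (hD _ _) _.
by rewrite ltnS !leq_max leqnn !orbT.
Qed.

Lemma mxcoef_system (dA : 'M[{poly F}]_n) (dB : 'M[{poly F}]_(n, p))
    (dC : 'M[{poly F}]_(p, n)) (dD : 'M[{poly F}]_p) i :
  mxcoef (system_mx dA dB dC dD) i =
  block_mx (- mxcoef dA i) (mxcoef dB i) (mxcoef dC i) (mxcoef dD i).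
Proof.
rewrite /mxcoef /system_mx map_block_mx; congr block_mx.
by apply/matrixP => j l; rewrite !mxE coefN.
Qed.

Lemma coef_bilinear_le E (v w : 'cV[F]_(n + p)) i : admissible_system E ->
  normc ((w^T *m mxcoef E i *m v) 0 0) <=
  vnorm2 w * vnorm2 v * block_weight kA kB kC kD a b c d i.
Proof.
case=> dA [dB [dC [dD [hA hB hC hD ->]]]]; rewrite mxcoef_system.
by apply: block_bilinear_le; apply: admissible_trunc.
Qed.

Lemma admissible_system_bilinear E (v w : 'cV[F]_(n + p)) x : admissible_system E ->
  normc ((w^T *m mxeval E x *m v) 0 0) <= vnorm2 w * vnorm2 v *
    \sum_(0 <= i < deg.+1) normc x ^+ i * block_weight kA kB kC kD a b c d i.
Proof.
move=> hE; rewrite (mxeval_coef x (admissible_system_deg hE)).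
rewrite mulmx_sumr mulmx_suml summxE big_mkord mulr_sumr.
apply: le_trans (normc_sum _ _ _) _; apply: ler_sum => i _.
rewrite -scalemxAr -scalemxAl mxE normcM normcX mulrCA.
by rewrite ler_wpM2l ?exprn_ge0 ?normc_ge0 ?coef_bilinear_le.
Qed.

(** The entries of a coefficient are its values on pairs of unit vectors. *)
Lemma admissible_system_bounded : exists W, forall E, admissible_system E ->
  forall i, (i <= deg)%N -> l1norm (mxcoef E i) <= W.
Proof.
pose t i := `|block_weight kA kB kC kD a b c d i|.
pose N := ((n + p) * (n + p))%:R : R.
exists (N * \sum_(i < deg.+1) t i) => E hE i ik.
apply: (@le_trans _ _ (N * t i)); last first.
  rewrite ler_wpM2l ?ler0n // (bigD1 (Ordinal (ik : (i < deg.+1)%N))) //= lerDl.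
  by apply: sumr_ge0 => l _; exact: normr_ge0.
apply: (@le_trans _ _ (\sum_(j < n + p) \sum_(l < n + p) t i)); last first.
  by rewrite !sumr_const !card_ord -mulrnA mulr_natl.
have nd (j : 'I_(n + p)) : vnorm2 (delta_mx j 0 : 'cV[F]_(n + p)) = 1.
  rewrite /vnorm2 (bigD1 j) //= big1 => [|k kj].
    by rewrite mxE !eqxx ComplexField.Normc.normc1 expr1n addr0 sqrtr1.
  by rewrite mxE (negPf kj) normc0 expr0n.
apply: ler_sum => j _; apply: ler_sum => l _.
have -> : mxcoef E i j l =
    ((delta_mx j (0 : 'I_1))^T *m mxcoef E i *m (delta_mx l (0 : 'I_1))) 0 0.
  by rewrite trmx_delta -rowE -colE !mxE.
apply: le_trans (coef_bilinear_le _ _ _ hE) _.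
by rewrite !nd !mul1r ler_norm.
Qed.

End AdmissiblePerturbations.

(** * Convergence to the supremum of the first-order terms *)

Section Limit.
Variable R : realType.

(** The upper bound is uniform in t, so it passes to the supremum. In the lower
    bound e1 may depend on t: a single t with k t close to the supremum is
    enough. *)
Lemma cvg_sup_of_bounds (T : Type) (S : R -> \bar R) (Q : set T) (k : T -> R) (c e0 : R) :
  Q !=set0 -> 0 <= c -> 0 < e0 ->
  (forall e, 0 < e <= e0 -> (S e <= (sup [set k t | t in Q] + c * e)%:E)%E) ->
  (forall t, Q t -> exists e1, 0 < e1 /\
     forall e, 0 < e <= e1 -> ((k t - c * e)%:E <= S e)%E) ->
  has_ubound [set k t | t in Q] ->
  S e @[e --> 0^'+] --> (sup [set k t | t in Q])%:E.
Proof.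
set K := sup _ => -[t0 Qt0] c0 e00 up lo ub.
have supK : has_sup [set k t | t in Q] by split=> //; exists (k t0), t0.
have fin : \forall e \near 0^'+, S e \is a fin_num.
  have [e1 [e10 lo1]] := lo _ Qt0.
  near=> e; have e_gt0 : 0 < e by [].
  have h1 : (S e <= (K + c * e)%:E)%E by apply: up; rewrite e_gt0 /=; near: e; exact: nbhs_right_le.
  have h2 : ((k t0 - c * e)%:E <= S e)%E by apply: lo1; rewrite e_gt0 /=; near: e; exact: nbhs_right_le.
  rewrite fin_numE; apply/andP; split; apply/eqP => Se.
    by move: h2; rewrite Se leeNy_eq.
  by move: h1; rewrite Se leye_eq.
apply/fine_cvgP; split => //; apply/cvgrPdist_le => eps eps0.
have h2 : 0 < eps / 2 by rewrite divr_gt0.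
have [_ [t Qt <-] Kt] := sup_adherent h2 supK.
have [e1 [e10 lo1]] := lo _ Qt.
have ec : 0 < eps / 2 / (c + 1) by rewrite divr_gt0 // ltr_wpDl.
near=> e; have e_gt0 : 0 < e by [].
have g1 : (S e <= (K + c * e)%:E)%E by apply: up; rewrite e_gt0 /=; near: e; exact: nbhs_right_le.
have g2 : ((k t - c * e)%:E <= S e)%E by apply: lo1; rewrite e_gt0 /=; near: e; exact: nbhs_right_le.
have g3 : e <= eps / 2 / (c + 1) by near: e; exact: nbhs_right_le.
have f : S e \is a fin_num by near: e.
rewrite -(fineK f) !lee_fin in g1 g2.
rewrite ler_pdivlMr ?ltr_wpDl // in g3.
by rewrite /= ler_norml; apply/andP; split; rewrite -/K in Kt *; nra.
Unshelve. all: by end_near. Qed.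

End Limit.

(** * The condition numbers *)

Theorem theorem5p2 (R : realType) (n p : nat) (kA kB kC kD : nat)
  (A : 'M[{poly R[i]}]_n) (B : 'M[{poly R[i]}]_(n, p))
  (C : 'M[{poly R[i]}]_(p, n)) (D : 'M[{poly R[i]}]_p)
  (hA : mxdeg_le kA A) (hB : mxdeg_le kB B)
  (hC : mxdeg_le kC C) (hD : mxdeg_le kD D)
  (regP : regular_pmx (system_mx A B C D)) (regA : regular_pmx A)
  (x : R[i])
  (simple_x : simple_zero x (transfer_mx A B C D))
  (min_x : minimal_at A B C x)
  (a b c d : nat -> R)
  (ha : forall i, (i <= kA)%N -> 0 <= a i)
  (hb : forall i, (i <= kB)%N -> 0 <= b i)
  (hc : forall i, (i <= kC)%N -> 0 <= c i)
  (hd : forall i, (i <= kD)%N -> 0 <= d i)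
  (v w : 'cV[R[i]]_(n + p))
  (hv : right_eigvec (system_mx A B C D) x v)
  (hw : left_eigvec (system_mx A B C D) x w)
  (r : R) (hr : isolating_radius (system_mx A B C D) x r) :
  cvg (structured_sup A B C D kA kB kC kD a b c d x v r e @[e --> 0^'+]) /\
  (kappaS A B C D kA kB kC kD a b c d x v r <=
   (kappaU (system_mx A B C D) (maxn (maxn kA kB) (maxn kC kD))
      (block_weight kA kB kC kD a b c d) x v w)%:E)%E.
Proof.
set P := system_mx A B C D in hv hw hr *.
set deg := maxn _ _; set wt := block_weight _ _ _ _ _ _ _ _.
have [v0 Pv] := hv; have [w0 wP] := hw; have [r0 isol] := hr.
have kl u := @system_kernel_line _ n p A B C D x regA simple_x min_x v u v0 Pv.
have [L [phi split_v]] := kernel_line_left_inverse kl Pv v0 w0 wP.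
have [h [detP hx]] := system_det_simple regA simple_x min_x hv hw.
have slope := system_deriv_neq0 regA simple_x min_x hv hw.
rewrite -/P in detP slope.
pose kap := (w^T *m mxeval (mxderiv P) x *m v) 0 0.
have kap0 : kap != 0.
  apply: contra_neq slope => kap0; apply/matrixP => i j.
  by rewrite !ord1 [RHS]mxE.
(* an isolating disc contains no root of the cofactor h of X - x in det P *)
have hroot z : ComplexField.Normc.normc z <= r -> ~~ root h (x + z).
  move=> zr; apply/negP => /eqP hz.
  have : x + z = x.
    apply: isol; last by rewrite addrAC subrr add0r.
    by apply/eigenvalue_det; rewrite detP hornerM hz mulr0.
  move=> /(canRL (addKr x)); rewrite addNr => z0; move: hz.
  by rewrite z0 addr0; apply/eqP.
have [lo [lo0 hlo]] := poly_lower_bound hroot (ltW r0).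
have detlo z : ComplexField.Normc.normc z <= r ->
    lo * ComplexField.Normc.normc z <= ComplexField.Normc.normc (\det P).[x + z].
  move=> zr; rewrite detP hornerM hornerXsubC [x + z]addrC addrK normcM mulrC.
  by rewrite ler_wpM2l ?normc_ge0 // addrC hlo.
pose Q := admissible_system (n := n) (p := p) kA kB kC kD a b c d.
have [W QW] := @admissible_system_bounded R n p kA kB kC kD a b c d.
have [cst [e0 [cst0 e00 est]]] := first_order wP split_v lo0 detlo kap0 deg W.
pose k E := ComplexField.Normc.normc ((w^T *m mxeval E x *m v) 0 0) /
  ComplexField.Normc.normc kap.
have kU E : Q E -> k E <= kappaU P deg wt x v w.
  move=> QE; rewrite /k /kappaU ler_wpM2r ?invr_ge0 ?normc_ge0 //.
  exact: admissible_system_bilinear.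
have ubk : has_ubound [set k E | E in Q].
  by exists (kappaU P deg wt x v w) => _ [E QE <-]; exact: kU.
have Q0 : Q !=set0.
  exists (system_mx 0 0 0 0); exists 0, 0, 0, 0.
  by split=> //; apply: admissible0.
have lim : structured_sup A B C D kA kB kC kD a b c d x v r e @[e --> 0^'+] -->
    (sup [set k E | E in Q])%:E.
  apply: (@cvg_sup_of_bounds _ _ _ _ _ cst e0) => //.
  - move=> e /andP[ep ee0]; apply: ge_ereal_sup => _ [dx [-> dxr]].
    move=> [dA [dB [dC [dD [dv [hdA hdB hdC hdD eig]]]]]]; rewrite lee_fin.
    have QE : Q (system_mx dA dB dC dD) by exists dA, dB, dC, dD.
    have := est _ (admissible_system_deg QE) (QW _ QE) e dx.
    rewrite ep ee0 => /(_ isT dxr); rewrite -/kap -/(k _).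
    move=> /(_ (ex_intro _ _ eig)); rewrite ler_norml => /andP[_ ?].
    by have := ub_le_sup ubk (ex_intro2 _ _ _ QE erefl); lra.
  - move=> E QE; have [e1 [e10 pers]] := simple_root_persists E detP hx r0.
    exists (Num.min e0 e1); split; first by rewrite lt_min e00.
    move=> e /andP[ep]; rewrite le_min => /andP[ee0 ee1].
    have [|dx [dxr eig]] := pers e; first by rewrite ep.
    have := est _ (admissible_system_deg QE) (QW _ QE) e dx.
    rewrite ep ee0 => /(_ isT dxr eig); rewrite -/kap -/(k _).
    rewrite ler_norml => /andP[h1 _].
    apply: (@le_trans _ _ (ComplexField.Normc.normc dx / e)%:E).
      by rewrite lee_fin; lra.
    apply: ereal_sup_ubound; exists dx; split=> //.
    case: QE => dA [dB [dC [dD [hdA hdB hdC hdD EE]]]].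
    (* the perturbation dv of v is whatever leads to the new eigenvector *)
    case: eig => u ueig.
    exists dA, dB, dC, dD, ((e%:C)^-1 *: (u - v)); split=> //.
    rewrite scalerA divff ?scale1r ?subrKC -?EE //.
    by rewrite -normc_gt0 normc_real normr_gt0 gt_eqF.
have kS : kappaS A B C D kA kB kC kD a b c d x v r = (sup [set k E | E in Q])%:E.
  exact/cvg_lim.
split; first by apply/cvg_ex; eexists; exact: lim.
rewrite kS lee_fin; apply: ge_sup; first by case: Q0 => E QE; exists (k E), E.
by move=> _ [E QE <-]; exact: kU.
Qed.
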